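(* Let $m,n\ge0$ be integers with $m+n\ge2$, let $k>1$ be an integer and $q=e^{i\pi/k}$. Let $U_q[sl(m|n)]$ act on the $k^m2^n$-dimensional Fock space $F_{1/k}(n|m)$ of $Cl_q(n|m)$ through its Cartan-Weyl elements $e_{jl}$ ($1\le j\ne l\le m+n$) and $\tilde H_j$ ($1\le j\le m+n-1$), represented by $$\rho(e_{jl})=\tfrac12(-1)^{\langle j\rangle}q^{-\left((-1)^{\langle l\rangle}N_l-\frac12\right)-1}\cdot q\,[\![c_j^-,c_l^+]\!]\quad(j<l),\qquad \rho(e_{jl})=\tfrac12(-1)^{\langle j\rangle}[\![c_j^-,c_l^+]\!]\,q^{(-1)^{\langle j\rangle}N_j-\frac12}\quad(j>l),$$ $$\rho(\tilde H_j)=-N_1-(-1)^{\langle j+1\rangle}N_{j+1}.$$ Let $|r_1,\ldots,r_{m+n})$, $0\le r_1,\ldots,r_m\le k-1$, $r_{m+1},\ldots,r_{m+n}\in\{0,1\}$, be the orthonormal basis of $F_{1/k}(n|m)$. (1) The matrix elements are $$\rho(\tilde H_j)|r_1,\ldots,r_{m+n})=-\bigl(r_1+(-1)^{\langle j+1\rangle}r_{j+1}\bigr)|r_1,\ldots,r_{m+n});$$ for $j<l$, $$\rho(e_{jl})|r_1,\ldots,r_{m+n})=-\bigl(1-(1-\langle l\rangle)r_l\bigr)(-1)^{(\langle j\rangle-\langle l\rangle)(r_1+\cdots+r_j)+(1-\langle l\rangle)(r_{j+1}+\cdots+r_{l-1})}\,e^{-i\pi\left(r_j+\cdots+r_{l-1}+(-1)^{\langle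 l\rangle}r_l-2\langle l\rangle\right)/k}\sqrt{\frac{\sin(\pi r_j/k)\sin(\pi(r_l+1)/k)}{\sin^2(\pi/k)}}\;|\ldots,r_j-1,\ldots,r_l+1,\ldots);$$ for $j>l$, $$\rho(e_{jl})|r_1,\ldots,r_{m+n})=-\bigl(1-(1-\langle l\rangle)r_l\bigr)(-1)^{(\langle l\rangle-\langle j\rangle)(r_1+\cdots+r_l)+(1-\langle j\rangle)(r_{l+1}+\cdots+r_{j-1})}\,e^{i\pi\left(r_l+\cdots+r_{j-1}+(-1)^{\langle j\rangle}r_j\right)/k}\sqrt{\frac{\sin(\pi r_j/k)\sin(\pi(r_l+1)/k)}{\sin^2(\pi/k)}}\;|\ldots,r_l+1,\ldots,r_j-1,\ldots),$$ where a term with vanishing coefficient is read as $0$. (2) For each integer $r$ with $0\le r\le m(k-1)+n$, the subspace $F_r(m|n)$ spanned by all basis vectors with $r_1+\cdots+r_{m+n}=r$ is an irreducible $U_q[sl(m|n)]$-submodule, and $F_{1/k}(n|m)=\bigoplus_{r=0}^{m(k-1)+n}F_r(m|n)$ is a direct sum of $mk-m+n+1$ irreducible $U_q[sl(m|n)]$-modules.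
   Context: Notation: $\langle i\rangle=1$ for $i\le m$ and $\langle i\rangle=0$ for $i>m$; $[x]=\frac{q^x-q^{-x}}{q-q^{-1}}$; $[r]!=[r][r-1]\cdots[1]$; $q^{A}=e^{i\pi A/k}$; $c_q=\frac{2}{q^{1/2}+q^{-1/2}}=1/\cos(\pi/(2k))$; $[\![a,b]\!]=ab-(-1)^{\deg(a)\deg(b)}ba$ with $\deg(c_i^\pm)=\langle i\rangle$. The prefactor in $\rho(e_{jl})$ for $j<l$ is simply $\frac12(-1)^{\langle j\rangle}\,\bar q^{\,(-1)^{\langle l\rangle}N_l-1/2}$ with $\bar q=q^{-1}$. The deformed Clifford superalgebra $Cl_q(n|m)$ has generators $c_i^\pm,N_i$ ($i=1,\ldots,m+n$) and relations - $[N_i,N_j]=0$, $[N_i,c_j^\pm]=\pm\delta_{ij}c_j^\pm$; - $c_i^+c_i^-=c_q[N_i]$, $c_i^-c_i^+=c_q[1-(-1)^{\langle i\rangle}N_i]$ (equivalently $c_i^-c_i^+ +(-1)^{\langle i\rangle}q^{\pm1}c_i^+c_i^-=c_q\,q^{\pm(-1)^{\langle i\rangle}N_i}$ for both signs); - $c_i^\xi c_j^\eta=-(-1)^{\langle j\rangle}q^{\xi\eta}c_j^\eta c_i^\xi$ for $i<j$, $\xi,\eta=\pm$ (identified with $\pm1$); - $(c_i^\pm)^2=0$ for $i>m$. The Fock space $F(n|m)$ is the $Cl_q(n|m)$-module generated by $|0\rangle$ with $c_i^-|0\rangle=0$, $N_i|0\rangle=0$, in which the vectors $|r_1,\ldots,r_{m+n}\rangle=(c_1^+)^{r_1}\cdots(c_{m+n}^+)^{r_{m+n}}|0\rangle$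 ($r_i\in\mathbb{Z}_{\ge 0}$ for $i\le m$, $r_i\in\{0,1\}$ for $i>m$) form a basis. $F_{1/k}(n|m)=F(n|m)/I_{1/k}(n|m)$, where $I_{1/k}(n|m)$ is the invariant subspace spanned by the $|r_1,\ldots,r_{m+n}\rangle$ with $r_j\ge k$ for at least one $j\le m$. Its scalar product is the one with $(|0\rangle,|0\rangle)=1$, $(c_i^+)^\dagger=c_i^-$, $N_i^\dagger=N_i$, and its orthonormal basis is $$|r_1,\ldots,r_{m+n})=\bigl(c_q^{r_1+\cdots+r_{m+n}}[r_1]!\cdots[r_m]!\bigr)^{-1/2}|r_1,\ldots,r_{m+n}\rangle,\quad 0\le r_1,\ldots,r_m\le k-1,\ r_{m+1},\ldots,r_{m+n}\in\{0,1\}.$$ $U_q[sl(m|n)]$ is the quantum superalgebra of $sl(m|n)$ with Chevalley generators $\hat e_i=e_{i,i+1}$, $\hat f_i=e_{i+1,i}$, $\hat h_i$ ($i=1,\ldots,m+n-1$), where $\tilde H_i=\hat h_1+(-1)^{\theta_2}\hat h_2+\cdots+(-1)^{\theta_i}\hat h_i$ and $\theta_i=1-\langle i\rangle$. A $U_q[sl(m|n)]$-submodule of $F_{1/k}(n|m)$ is a subspace invariant under all $\rho(e_{jl})$ and $\rho(\tilde H_j)$. *)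

(* Defs.v *)
From HB Require Import structures.
From mathcomp Require Import all_boot all_order all_algebra.
From mathcomp Require Import sesquilinear complex.
From mathcomp Require Import boolp classical_sets reals trigo.

Set Implicit Arguments.
Unset Strict Implicit.
Unset Printing Implicit Defensive.

Import Order.TTheory GRing.Theory Num.Theory.

Local Open Scope classical_set_scope.
Local Open Scope ring_scope.
Local Open Scope complex_scope.

(* Indices run over 'I_(m + n), from 0: the ordinal i stands for i + 1 in the *)
(* usual numbering, so <i + 1> = 1 exactly when i < m.                        *)
Definition deg (m i : nat) : nat := (i < m)%N.

Section QNumbers.
Context {R : realType}.

Definition expi (x : R) : R[i] := cos x +i* sin x.

(* q ^ x = exp (i pi x / k) for real x *)
Definition qpow (k : nat) (x : R) : R[i] := expi (pi * x / k%:R).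

Definition qnum (k : nat) (x : R) : R[i] :=
  (qpow k x - qpow k (- x)) / (qpow k 1 - qpow k (- 1)).

Definition qfact (k r : nat) : R[i] := \prod_(1 <= s < r.+1) qnum k s%:R.

Definition cq (k : nat) : R[i] := 2 / (qpow k 2^-1 + qpow k (- 2^-1)).

End QNumbers.

Section Operators.
Context {R : realType} {V : lmodType R[i]}.
Implicit Types (A B : V -> V) (v : V).

(* q ^ A, defined through the spectral decomposition of A: if v is a finite   *)
(* sum of vectors x.2 with A x.2 = x.1 x.2 and x.1 real, then                 *)
(* q ^ A v is the sum of the q ^ x.1 x.2.  For linear A this does not depend  *)
(* on the decomposition; the value is 0 when there is none, which does not    *)
(* happen for the number operators of a Fock space.                           *)
Definition qpow_op (k : nat) A v : V :=
  xget 0 [set w | exists s : seq (R * V),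
    [/\ forall x, x \in s -> A x.2 = x.1%:C *: x.2,
        v = \sum_(x <- s) x.2 &
        w = \sum_(x <- s) qpow k x.1 *: x.2]].

Definition qnum_op (k : nat) A v : V :=
  (qpow k 1 - qpow k (- 1))^-1 *:
    (qpow_op k A v - qpow_op k (fun u => - A u) v).

(* [[A, B]] for A of degree da and B of degree db *)
Definition superbracket (da db : nat) A B v : V :=
  A (B v) - (-1) ^+ (da * db) *: B (A v).

Definition lspan (I : choiceType) (P : pred I) (e : I -> V) : set V :=
  [set v | exists (s : seq I) (a : I -> R[i]),
    all P s /\ v = \sum_(i <- s) a i *: e i].

(* the e i with P i form a (possibly infinite) basis of V *)
Definition lbasis (I : choiceType) (P : pred I) (e : I -> V) : Prop :=
  (forall v, lspan P e v) /\
  (forall (s : seq I) (a : I -> R[i]), uniq s -> all P s ->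
     \sum_(i <- s) a i *: e i = 0 -> forall i, i \in s -> a i = 0).

Definition direct_sum (N : nat) (S : 'I_N -> set V) : Prop :=
  forall v, exists! f : {ffun 'I_N -> V},
    (forall r, S r (f r)) /\ v = \sum_(r < N) f r.

End Operators.

(* xi : bool is the superscript of c_i^xi, true for + and false for - *)
Definition pm {A : pzRingType} (xi : bool) : A := if xi then 1 else -1.

(* Modules over Cl_q(n|m), at q = exp (i pi / k) *)
Record clqModule (R : realType) (m n k : nat) := ClqModule {
  clq_sort :> lmodType R[i];
  cl : bool -> 'I_(m + n) -> {linear clq_sort -> clq_sort};
  nb : 'I_(m + n) -> {linear clq_sort -> clq_sort};
  nbC : forall i j v, nb i (nb j v) = nb j (nb i v);
  nb_cl : forall xi i j v,
    nb i (cl xi j v) - cl xi j (nb i v) = (pm xi * (i == j)%:R) *: cl xi j v;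
  cl_pm : forall i v,
    cl true i (cl false i v) = cq k *: qnum_op k (nb i) v;
  cl_mp : forall i v,
    cl false i (cl true i v) =
      cq k *: qnum_op k (fun u => u - (-1) ^+ deg m i *: nb i u) v;
  cl_cl : forall xi eta (i j : 'I_(m + n)) v, (i < j)%N ->
    cl xi i (cl eta j v) =
      (- (-1) ^+ deg m j * qpow k (pm xi * pm eta)) *: cl eta j (cl xi i v);
  cl_sq : forall xi (i : 'I_(m + n)) v, (m <= i)%N -> cl xi i (cl xi i v) = 0
}.

(* occupation numbers (r_1, ..., r_{m+n}) *)
Notation occ m n := {ffun 'I_(m + n) -> nat}.

Section Fock.
Context {R : realType} {m n k : nat}.
Implicit Types (F W : clqModule R m n k).

Local Notation occ := (occ m n).

Definition fock_occ (r : occ) : bool :=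
  [forall i : 'I_(m + n), (m <= i)%N ==> (r i <= 1)%N].

Definition trunc_occ (r : occ) : bool :=
  fock_occ r && [forall i : 'I_(m + n), (i < m)%N ==> (r i < k)%N].

Definition ket F (vac : F) (r : occ) : F :=
  foldr (fun i v => iter (r i) (cl F true i) v) vac (enum 'I_(m + n)).

Definition is_fock F (vac : F) : Prop :=
  [/\ forall i, cl F false i vac = 0,
      forall i, nb F i vac = 0 &
      lbasis fock_occ (ket vac)].

(* I_{1/k} *)
Definition fock_ideal F (vac : F) : set F :=
  lspan [pred r : occ | fock_occ r && [exists i : 'I_(m + n), (i < m)%N && (k <= r i)%N]]
        (ket vac).

(* p : F -> W exhibits W as the quotient module F / I_{1/k} *)
Definition is_truncation F (vac : F) W (p : {linear F -> W}) : Prop :=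
  [/\ forall xi i v, p (cl F xi i v) = cl W xi i (p v),
      forall i v, p (nb F i v) = nb W i (p v),
      forall w, exists v, p v = w &
      forall v, p v = 0 <-> fock_ideal vac v].

Definition is_fock_product W (vac : W) (dot : W -> W -> R[i]) : Prop :=
  [/\ dot vac vac = 1,
      forall i u v, dot (cl W true i u) v = dot u (cl W false i v) &
      forall i u v, dot (nb W i u) v = dot u (nb W i v)].

(* |r_1, ..., r_{m+n}) *)
Definition nket W (vac : W) (r : occ) : W :=
  (sqrtC (cq k ^+ (\sum_i r i) * \prod_(i < m + n | (i < m)%N) qfact k (r i)))^-1 *:
    ket vac r.

Definition rho_e W (j l : 'I_(m + n)) : W -> W :=
  let bracket :=
    superbracket (deg m j) (deg m l) (cl W false j) (cl W true l) in
  if (j < l)%N then fun v =>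
    (2^-1 * (-1) ^+ deg m j) *:
      qpow_op k (fun u => - ((-1) ^+ deg m l *: nb W l u - 2^-1 *: u) - u)
        (qpow k 1 *: bracket v)
  else fun v =>
    (2^-1 * (-1) ^+ deg m j) *:
      bracket (qpow_op k (fun u => (-1) ^+ deg m j *: nb W j u - 2^-1 *: u) v).

(* For j : 'I_(m + n).-1, the indices 0 and j + 1 as elements of 'I_(m + n) *)
Lemma ord_next_subproof (N : nat) (j : 'I_N.-1) : (j.+1 < N)%N.
Proof. by case: N j => [|N] [] //= j. Qed.

Definition ord_next (N : nat) (j : 'I_N.-1) : 'I_N := Ordinal (ord_next_subproof j).

Definition ord_first (N : nat) (j : 'I_N.-1) : 'I_N :=
  Ordinal (leq_ltn_trans (leq0n j.+1) (ord_next_subproof j)).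

(* The ordinal j stands for H~_{j+1} in the usual numbering. *)
Definition rho_H W (j : 'I_(m + n).-1) (v : W) : W :=
  - nb W (ord_first j) v - (-1) ^+ deg m (ord_next j) *: nb W (ord_next j) v.

Definition submodule W (S : set W) : Prop :=
  [/\ submod_closed (mem S),
      forall j l v, j != l -> S v -> S (rho_e j l v) &
      forall j v, S v -> S (rho_H j v)].

Definition irreducible_submodule W (S : set W) : Prop :=
  [/\ submodule S, S <> [set 0] &
      forall T : set W, submodule T -> T `<=` S -> T = [set 0] \/ T = S].

(* F_r(m|n) *)
Definition fock_layer W (vac : W) (r : nat) : set W :=
  lspan [pred s : occ | trunc_occ s && (\sum_i s i == r)%N] (nket vac).

(* one particle moved from place j to place l *)
Definition hop (j l : 'I_(m + n)) (r : occ) : occ :=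
  [ffun i => if i == j then (r i).-1 else if i == l then (r i).+1 else r i].

Definition hop_amplitude (j l : 'I_(m + n)) (r : occ) : R[i] :=
  (Num.sqrt (sin (pi * (r j)%:R / k%:R) * sin (pi * (r l).+1%:R / k%:R)
             / sin (pi / k%:R) ^+ 2) : R)%:C.

End Fock.

Arguments trunc_occ {m n} k r.
Arguments hop_amplitude {R m n} k j l r.

(* Main.v *)
(* The number operators act diagonally on the kets, c_l^+ r = phase . (r + 1_l), *)
(* and c_j^- on a ket with r_j > 0 is read off c_j^- c_j^+ applied to the ket   *)
(* with one particle less.  Positivity of the scalar product gives c_j^- r = 0  *)
(* when r_j = 0, so the normalized kets are orthonormal and coordinates are     *)
(* scalar products.  Since the supercommutator [[c_j^-, c_l^+]] is a multiple   *)
(* of c_l^+ c_j^-, the operator rho(e_jl) moves one particle from j to l.       *)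
(* Irreducibility cannot rest on weights: for m = n, and for (m, n) = (0, 2),   *)
(* the H~_j do not separate the kets of a layer.  Instead, two distinct kets r, *)
(* s of the same layer have places j, l with r_j > s_j and r_l < s_l, and a     *)
(* power of e_jl kills s but not r.  So every nonzero submodule of a layer      *)
(* contains a ket, and hops connect all kets of the layer.                      *)

Require Import Defs.
From HB Require Import structures.
From mathcomp Require Import all_boot all_order all_algebra.
From mathcomp Require Import sesquilinear complex.
From mathcomp Require Import boolp classical_sets reals trigo.
From mathcomp Require Import zify ring lra.

Set Implicit Arguments.
Unset Strict Implicit.
Unset Printing Implicit Defensive.

Import Order.TTheory GRing.Theory Num.Theory.

Local Open Scope classical_set_scope.
Local Open Scope ring_scope.
Local Open Scope complex_scope.

(** * q-numbers at a root of unity *)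

(** The generators send each ket to a multiple of a ket, so the theorem reduces to phases, norms and
    the question of which coefficients vanish. The exchange relations give the phase of $c_l^+$ on a
    ket ([cl_ket]), the relation for $c_j^-c_j^+$ gives the factor $c_q[r_j]$ of $c_j^-$
    ([cl_down_ket]), and adjointness turns the latter into squared norms ([dot_ket]), positive
    because $[r]>0$ for $0<r<k$ ([nrm_gt0]). The quotient enters through three facts: the $N_i$ kill
    its vacuum, its kets outside the truncated range vanish, and the remaining kets span.
    Independence of the kets then follows from orthonormality ([nket_orthonormal], [nket_lbasis]).

    For the matrix elements, the supercommutator is a scalar multiple of $c_l^+c_j^-$
    ([superbracket_lt], [superbracket_gt]). Its scalar, the $\frac12$ and $c_q$ merge into a sign
    and a power of $q$ ([cq_half_down], [cq_half_up]); signs and exponents are then compared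
    separately ([sign_lt], [phase_lt], [sign_gt], [phase_gt]). The coefficient is nonzero exactly
    when place $j$ is occupied and place $l$ is not full ([e_coef_neq0]).

    Irreducibility rests on this nonvanishing and on the injectivity of hops ([hop_inj]). A vector
    whose support has two kets is hopped until one of them is lost while the other survives, which
    ends at a single ket ([submodule_has_nket]); from there hops reach the whole layer
    ([submodule_nket_all]). *)

Section QNumberTheory.
Context {R : realType} {k : nat}.
Hypothesis hk : (1 < k)%N.
Implicit Types x y : R.

Lemma expiD x y : expi (x + y) = expi x * expi y.
Proof. by rewrite /expi cosD sinD; simpc; congr Complex; rewrite addrC. Qed.

Lemma normr_expi x : `|expi x| = 1.
Proof. by rewrite normc_def /= cos2Dsin2 sqrtr1. Qed.

Lemma qpowD x y : qpow k (x + y) = qpow k x * qpow k y.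
Proof. by rewrite /qpow mulrDr mulrDl expiD. Qed.

Lemma qpow0 : qpow k (0 : R) = 1.
Proof. by rewrite /qpow mulr0 mul0r /expi cos0 sin0. Qed.

Lemma normr_qpow x : `|qpow k x| = 1.
Proof. exact: normr_expi. Qed.

Lemma qpow_neq0 x : qpow k x != 0.
Proof. by rewrite -normr_eq0 normr_qpow oner_eq0. Qed.

Lemma qpowN x : qpow k (- x) = (qpow k x)^-1.
Proof.
by apply: (mulfI (qpow_neq0 x)); rewrite -qpowD subrr qpow0 divff ?qpow_neq0.
Qed.

Lemma qpowMn x (s : nat) : qpow k x ^+ s = qpow k (x * s%:R).
Proof.
elim: s => [|s IHs]; first by rewrite expr0 mulr0 qpow0.
by rewrite exprS IHs -qpowD -[s.+1]addn1 natrD mulrDr mulr1 addrC.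
Qed.

Lemma sin_frac_gt0 (r : nat) : (0 < r < k)%N -> 0 < sin (pi * r%:R / k%:R : R).
Proof.
move=> /andP[r0 rk]; have k0 : 0 < (k%:R : R) by rewrite ltr0n; lia.
apply: sin_gt0_pi; apply/andP; split.
  by rewrite divr_gt0 // mulr_gt0 ?pi_gt0 // ltr0n.
by rewrite ltr_pdivrMr // ltr_pM2l ?pi_gt0 // ltr_nat.
Qed.

Lemma sin_unit_gt0 : 0 < sin (pi / k%:R : R).
Proof. by have := @sin_frac_gt0 1; rewrite mulr1; apply; rewrite hk. Qed.

Lemma qnum_sin x : qnum k x = (sin (pi * x / k%:R) / sin (pi / k%:R))%:C.
Proof.
have qpow_sub y : qpow k y - qpow k (- y) = 2 * 'i * (sin (pi * y / k%:R))%:C.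
  rewrite /qpow mulrN mulNr /expi cosN sinN.
  rewrite (_ : 2 = (2 : R)%:C) ?rmorphMn //; simpc.
  by congr Complex; ring.
rewrite /qnum !qpow_sub mulr1 -mulf_div divff ?mul1r ?rmorphM ?fmorphV //=.
by rewrite mulf_neq0 ?pnatr_eq0 // eq_complex /= oner_eq0 andbF.
Qed.

(** The $q$-integer $[r]$, real at this root of unity; as an element of [R] it can be compared with
    0 and put under square roots. *)
Definition qn (r : nat) : R := sin (pi * r%:R / k%:R) / sin (pi / k%:R).

Lemma qnum_nat (r : nat) : qnum k (r%:R : R) = (qn r)%:C.
Proof. exact: qnum_sin. Qed.

Lemma qn0 : qn 0 = 0.
Proof. by rewrite /qn mulr0 mul0r sin0 mul0r. Qed.

Lemma qn1 : qn 1 = 1.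
Proof. by rewrite /qn mulr1 divff // gt_eqF // sin_unit_gt0. Qed.

(** Since $\sin\pi=0$, the amplitude of a hop onto a place already holding $k-1$ particles vanishes,
    in accordance with the truncation. *)
Lemma qnk : qn k = 0.
Proof. by rewrite /qn mulfK ?sinpi ?mul0r // pnatr_eq0; lia. Qed.

Lemma qn_gt0 (r : nat) : (0 < r < k)%N -> 0 < qn r.
Proof. by move=> rk; rewrite divr_gt0 ?sin_unit_gt0 ?sin_frac_gt0. Qed.

Definition rcq : R := (cos (pi / (2 * k%:R)))^-1.

Lemma rcq_gt0 : 0 < rcq.
Proof.
rewrite invr_gt0; apply: cos_gt0_pihalf.
have k1 : 1 < (k%:R : R) by rewrite ltr1n.
have p0 := pi_gt0 R.
rewrite (lt_trans (y := 0)) ?oppr_lt0 ?divr_gt0 //=; try lra.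
by rewrite ltr_pM2l // ltf_pV2 ?posrE; lra.
Qed.

Lemma qpow_half : qpow k 2^-1 + qpow k (- 2^-1) = 2 / rcq%:C :> R[i].
Proof.
rewrite /rcq fmorphV invrK /qpow mulrN mulNr /expi cosN sinN.
rewrite (_ : pi / 2 / k%:R = pi / (2 * k%:R)); last by rewrite invfM mulrA.
rewrite (_ : 2 = (2 : R)%:C) ?rmorphMn //; simpc.
by congr Complex; ring.
Qed.

Lemma cq_real : cq k = rcq%:C :> R[i].
Proof.
by rewrite /cq qpow_half invfM invrK mulVKf // pnatr_eq0.
Qed.

(** Factoring $q^{1/2}$ out of $1+q$ leaves the denominator of $c_q$. So the $\frac12$ of [rho_e],
    the $c_q$ of the ladder relations and the $1+q$ of the supercommutator combine to a pure
    phase. *)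
Lemma cq_half_up : 2^-1 * cq k * (1 + qpow k 1) = qpow k 2^-1 :> R[i].
Proof.
have -> : 1 + qpow k 1 = qpow k 2^-1 * (2 / rcq%:C) :> R[i].
  by rewrite -qpow_half mulrDr -!qpowD subrr qpow0 addrC -div1r -splitr.
rewrite cq_real mulrCA mulrACA mulVf ?pnatr_eq0 // mul1r divff ?mulr1 //.
by rewrite fmorph_eq0 gt_eqF ?rcq_gt0.
Qed.

Lemma cq_half_down : 2^-1 * cq k * (1 + qpow k (- 1)) = qpow k (- 2^-1) :> R[i].
Proof.
have -> : 1 + qpow k (- 1) = qpow k (- 1) * (1 + qpow k 1) :> R[i].
  by rewrite mulrDr mulr1 -qpowD addNr qpow0 addrC.
rewrite mulrCA cq_half_up -qpowD; congr qpow; lra.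
Qed.

End QNumberTheory.

Arguments qn {R} k r.
Arguments rcq {R} k.

(** * Functions of a diagonalizable operator *)

Section SpectralPower.
Context {R : realType} {V : lmodType R[i]}.
Implicit Types (A : V -> V) (s : seq (R * V)).

Lemma linear_fun0 A (linA : linear A) : A 0 = 0.
Proof. by have := linA (-1) 0 0; rewrite scaler0 addr0 scaleN1r addNr. Qed.

Lemma linear_fun_comp (f g : V -> V) :
  linear f -> linear g -> linear (fun v => f (g v)).
Proof. by move=> linf ling a u v; rewrite ling linf. Qed.

Lemma linear_fun_scale (c : R[i]) (f : V -> V) :
  linear f -> linear (fun v => c *: f v).
Proof.
by move=> linf a u v; rewrite linf scalerDr !scalerA mulrC.
Qed.

Lemma linear_fun_sum A (linA : linear A) (I : Type) (s : seq I) (a : I -> R[i])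
    (e : I -> V) :
  A (\sum_(i <- s) a i *: e i) = \sum_(i <- s) a i *: A (e i).
Proof.
elim: s => [|i s IHs]; first by rewrite !big_nil linear_fun0.
by rewrite !big_cons linA IHs.
Qed.

(* Applying A - z for every z in zs multiplies an eigenvector of value x by *)
(* the product of the x - z. *)
Lemma eigen_sum_prod A (linA : linear A) s (zs : seq R) :
  (forall x, x \in s -> A x.2 = x.1%:C *: x.2) ->
  \sum_(x <- s) x.2 = 0 ->
  \sum_(x <- s) (\prod_(z <- zs) (x.1 - z)%:C) *: x.2 = 0.
Proof.
move=> eigA s0; elim: zs => [|z zs IHz].
  by rewrite -[RHS]s0; apply: eq_bigr => x _; rewrite big_nil scale1r.
transitivity (A (\sum_(x <- s) (\prod_(z <- zs) (x.1 - z)%:C) *: x.2) -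
    z%:C *: \sum_(x <- s) (\prod_(z <- zs) (x.1 - z)%:C) *: x.2); last first.
  by rewrite IHz scaler0 subr0 linear_fun0.
rewrite linear_fun_sum // scaler_sumr -sumrB [LHS]big_seq [RHS]big_seq.
apply: eq_bigr => x xs.
by rewrite eigA // big_cons !scalerA -scalerBl rmorphB; congr (_ *: _); ring.
Qed.

Lemma eigen_sum_fun A (linA : linear A) s (g : R -> R[i]) :
  (forall x, x \in s -> A x.2 = x.1%:C *: x.2) ->
  \sum_(x <- s) x.2 = 0 -> \sum_(x <- s) g x.1 *: x.2 = 0.
Proof.
move=> eigA s0; pose us := undup [seq x.1 | x <- s].
(* Multiplying by $x-z$ over all eigenvalues $z\ne y$ leaves only the eigenvectors of value $y$,
   with a nonzero common factor. *)
have part y : \sum_(x <- s | x.1 == y) x.2 = 0.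
  have := eigen_sum_prod linA (rem y us) eigA s0.
  have -> : \sum_(x <- s) (\prod_(z <- rem y us) (x.1 - z)%:C) *: x.2 =
      (\prod_(z <- rem y us) (y - z)%:C) *: \sum_(x <- s | x.1 == y) x.2.
    rewrite scaler_sumr [RHS]big_mkcond [LHS]big_seq [RHS]big_seq.
    apply: eq_bigr => x xs; case: eqP => [-> //|/eqP ney].
    have xu : x.1 \in rem y us.
      by rewrite mem_rem_uniq ?undup_uniq // inE ney mem_undup map_f.
    by rewrite (big_rem _ xu) /= subrr mul0r scale0r.
  move/eqP; rewrite scaler_eq0 -[X in X || _]negbK prodf_seq_neq0.
  case/orP => [|/eqP//]; case/negP; apply/allP => z.
  rewrite mem_rem_uniq ?undup_uniq // inE => /andP[zy _].
  by rewrite fmorph_eq0 subr_eq0 eq_sym zy.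
transitivity (\sum_(y <- us) g y *: \sum_(x <- s | x.1 == y) x.2); last first.
  by rewrite big1 // => y _; rewrite part scaler0.
under [RHS]eq_bigr do rewrite scaler_sumr big_mkcond.
rewrite exchange_big /= [LHS]big_seq [RHS]big_seq; apply: eq_bigr => x xs.
have xu : x.1 \in us by rewrite mem_undup map_f.
rewrite (big_rem _ xu) /= eqxx big_seq big1 ?addr0 // => y.
rewrite mem_rem_uniq ?undup_uniq // inE => /andP[ny _].
by rewrite eq_sym (negbTE ny).
Qed.

(** Two decompositions of one vector, one of them with opposite sign, form eigenvectors of sum zero;
    by [eigen_sum_fun] they give the same value of $q^A$, so the choice in [qpow_op] is forced. *)
Lemma qpow_opE (k : nat) A (linA : linear A) s :
  (forall x, x \in s -> A x.2 = x.1%:C *: x.2) ->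
  qpow_op k A (\sum_(x <- s) x.2) = \sum_(x <- s) qpow k x.1 *: x.2.
Proof.
move=> eigA; apply: xget_unique; first by exists s.
move=> _ [t [eigt st ->]]; apply/eqP; rewrite -subr_eq0; apply/eqP.
have linAN (v : V) : A (- v) = - A v.
  by have := linA (-1) v 0; rewrite (linear_fun0 linA) !addr0 !scaleN1r.
pose u := t ++ [seq (x.1, - x.2) | x <- s].
have eigu x : x \in u -> A x.2 = x.1%:C *: x.2.
  rewrite mem_cat => /orP[/eigt//|/mapP[y ys ->]] /=.
  by rewrite linAN eigA // scalerN.
have u0 : \sum_(x <- u) x.2 = 0 by rewrite big_cat big_map /= sumrN st subrr.
have := eigen_sum_fun linA (qpow k) eigu u0.
rewrite big_cat big_map /=.
by under [X in _ + X]eq_bigr do rewrite scalerN; rewrite sumrN.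
Qed.

Lemma qpow_op_eigen (k : nat) A (linA : linear A) (x : R) v :
  A v = x%:C *: v -> qpow_op k A v = qpow k x *: v.
Proof.
move=> eigv; have := @qpow_opE k A linA [:: (x, v)].
by rewrite !big_seq1 => -> // _ /[!inE] /eqP ->.
Qed.

Lemma qpow_op_eigenZ (k : nat) A (linA : linear A) (x : R) (c : R[i]) v :
  A v = x%:C *: v -> qpow_op k A (c *: v) = (qpow k x * c) *: v.
Proof.
move=> eigv; rewrite (qpow_op_eigen k linA (x := x)) ?scalerA //.
have := linA c v 0; rewrite (linear_fun0 linA) !addr0 => ->.
by rewrite eigv !scalerA mulrC.
Qed.

Lemma qnum_op_eigen (k : nat) A (linA : linear A) (x : R) v :
  A v = x%:C *: v -> qnum_op k A v = qnum k x *: v.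
Proof.
move=> eigv; rewrite /qnum_op (qpow_op_eigen k linA eigv).
have linN : linear (fun u => - A u).
  by move=> a u w; rewrite linA opprD scalerN.
rewrite (qpow_op_eigen k linN (x := - x)); last by rewrite eigv rmorphN scaleNr.
by rewrite -scalerBl scalerA mulrC.
Qed.

End SpectralPower.

(** * Occupation numbers and hops *)

Section Occupations.
Context {m n k : nat}.
Hypothesis hk : (1 < k)%N.
Local Notation I := 'I_(m + n).
Local Notation occ := (occ m n).
Implicit Types (r s t : occ) (i j l : I).

Definition cap (i : nat) : nat := if (i < m)%N then k.-1 else 1%N.

Lemma cap_lt i : (cap i < k)%N.
Proof. by rewrite /cap; case: ifP => _; lia. Qed.

Lemma trunc_occP r : reflect (forall i, (r i <= cap i)%N) (trunc_occ k r).
Proof.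
apply: (iffP andP) => [[/forallP f /forallP b] i|rcap].
  by move: (f i) (b i); rewrite /cap; case: (ltnP i m) => //= _ _; lia.
by split; apply/forallP => i; move: (rcap i);
   rewrite /cap; case: (ltnP i m) => //= _; lia.
Qed.

Lemma trunc_occ_lt r : trunc_occ k r -> forall i, (r i < k)%N.
Proof. by move=> /trunc_occP rcap i; apply: leq_ltn_trans (rcap i) (cap_lt i). Qed.

Definition inc l r : occ := [ffun i => if i == l then (r i).+1 else r i].
Definition dec j r : occ := [ffun i => if i == j then (r i).-1 else r i].

Lemma inc_dec j r : (0 < r j)%N -> inc j (dec j r) = r.
Proof.
move=> rj; apply/ffunP => i; rewrite !ffunE.
by case: eqP => [->|//]; rewrite prednK.
Qed.

Lemma inc_hop j l r : j != l -> hop j l r = inc l (dec j r).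
Proof.
move=> jl; apply/ffunP => i; rewrite !ffunE; case: eqP => [->|_]; last by [].
by rewrite (negbTE jl).
Qed.

Lemma dec_trunc j r : trunc_occ k r -> trunc_occ k (dec j r).
Proof.
move=> /trunc_occP rc; apply/trunc_occP => i; rewrite ffunE.
by case: ifP => _; have := rc i; lia.
Qed.

Lemma inc_trunc l r :
  trunc_occ k r -> (r l < cap l)%N -> trunc_occ k (inc l r).
Proof.
move=> /trunc_occP rc rl; apply/trunc_occP => i; rewrite ffunE.
by case: eqP => [->|].
Qed.

Lemma sum_inc l r : (\sum_i inc l r i = (\sum_i r i).+1)%N.
Proof.
rewrite (bigD1 l) //= [in RHS](bigD1 l) //= ffunE eqxx addSn; congr (_ + _).+1.
by apply: eq_bigr => i /negbTE il; rewrite ffunE il.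
Qed.

(** For distinct places and a truncated [r] this is exactly the condition for a nonzero matrix
    element, see [e_coef_neq0]. *)
Definition movable j l r := (0 < r j)%N && (r l < cap l)%N.

Lemma hop_trunc j l r : j != l ->
  trunc_occ k r -> movable j l r -> trunc_occ k (hop j l r).
Proof.
move=> jl tr /andP[_ rl]; rewrite inc_hop // inc_trunc ?dec_trunc //.
by rewrite ffunE eq_sym (negbTE jl).
Qed.

Lemma sum_hop j l r : j != l -> (0 < r j)%N -> (\sum_i hop j l r i = \sum_i r i)%N.
Proof. by move=> jl rj; rewrite inc_hop // sum_inc -(sum_inc j) inc_dec. Qed.

Lemma hop_inj j l r s : j != l -> (0 < r j)%N -> (0 < s j)%N ->
  hop j l r = hop j l s -> r = s.
Proof.
move=> jl rj sj /ffunP e; apply/ffunP => i; move: (e i); rewrite !ffunE.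
case: eqP => [->|_]; last by case: ifP => _ // [].
by move/(congr1 succn); rewrite !prednK.
Qed.

Lemma occ_neq_gt r s : (\sum_i r i = \sum_i s i)%N -> r != s ->
  exists j, (s j < r j)%N.
Proof.
move=> ers; apply: contraNP => nex.
have le j : (r j <= s j)%N by rewrite leqNgt; apply/negP => ?; apply: nex; exists j.
apply/eqP/ffunP => j; apply/eqP; rewrite eqn_leq le /= leqNgt; apply/negP => lt.
suff : (\sum_i r i < \sum_i s i)%N by rewrite ers ltnn.
rewrite (bigD1 j) //= [X in (_ < X)%N](bigD1 j) //= -addSn leq_add //.
by apply: leq_sum => i _.
Qed.

(** Equal totals force an excess of [r] over [s] somewhere and a deficit elsewhere; as [s] respects
    the capacities, the deficit leaves room for a hop. This serves both to separate two kets and to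
    connect them. *)
Lemma occ_neq_hop r s : trunc_occ k r -> trunc_occ k s ->
  (\sum_i r i = \sum_i s i)%N -> r != s ->
  exists j l, [/\ j != l, (s j < r j)%N, (r l < s l)%N & movable j l r].
Proof.
move=> tr ts ers rs; have [j sj] := occ_neq_gt ers rs.
have [|l rl] := occ_neq_gt (esym ers); first by rewrite eq_sym.
exists j, l; split=> //; first by apply/eqP => jl; rewrite jl in sj; lia.
rewrite /movable (leq_ltn_trans _ sj) //=.
by move/trunc_occP: ts => /(_ l); apply: leq_trans.
Qed.

Lemma sum_cap : (\sum_(i < m + n) cap i = m * (k - 1) + n)%N.
Proof.
rewrite big_split_ord /=.
under eq_bigr => i _ do rewrite /cap ltn_ord.
under [X in (_ + X)%N]eq_bigr => i _ do rewrite /cap ltnNge leq_addr.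
by rewrite !big_const_ord !iter_addn_0 mul1n mulnC subn1.
Qed.

Lemma sum_trunc_le r : trunc_occ k r -> (\sum_i r i <= m * (k - 1) + n)%N.
Proof. by move=> /trunc_occP rc; rewrite -sum_cap; apply: leq_sum => i _. Qed.

Lemma trunc_sum_surj (a : nat) : (a <= m * (k - 1) + n)%N ->
  exists2 r : occ, trunc_occ k r & (\sum_i r i = a)%N.
Proof.
elim: a => [_|a IHa lea].
  exists [ffun=> 0%N]; first by apply/trunc_occP => i; rewrite ffunE.
  by rewrite big1 // => i _; rewrite ffunE.
have [|r tr ra] := IHa; first by lia.
(* If all places were full, the total would be the sum of all capacities. *)
have [l rl] : exists l, (r l < cap l)%N.
  apply: contrapT => nex; suff : (m * (k - 1) + n <= a)%N by lia.
  rewrite -sum_cap -ra; apply: leq_sum => i _; rewrite leqNgt.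
  by apply/negP => ri; apply: nex; exists i.
by exists (inc l r); [exact: inc_trunc | rewrite sum_inc ra].
Qed.

(** [occ] is not a finite type; truncated occupation numbers all lie below [k], so they are listed
    through functions into ['I_k]. *)
Definition states : seq occ :=
  undup [seq r <- [seq [ffun i => val (f i)] | f : {ffun I -> 'I_k}] | trunc_occ k r].

Lemma states_uniq : uniq states. Proof. exact: undup_uniq. Qed.

Lemma mem_states r : (r \in states) = trunc_occ k r.
Proof.
rewrite mem_undup mem_filter; case tr: (trunc_occ k r) => //=.
apply/mapP; exists [ffun i => Ordinal (trunc_occ_lt tr i)]; first exact: mem_enum.
by apply/ffunP => i; rewrite !ffunE.
Qed.

End Occupations.

Arguments cap m k i : clear implicits.
Arguments movable {m n} k j l r.
Arguments states {m n} k.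

(** * Action of the Clifford generators on kets *)

Section Ladder.
Context {R : realType} {m n k : nat}.
Context (W : clqModule R m n k) (vac : W).
Hypothesis nb_vac : forall i, nb W i vac = 0.
Local Notation I := 'I_(m + n).
Local Notation occ := (occ m n).
Local Notation K := (ket vac).
Implicit Types (r s : occ) (i j l : I) (v : W).

(** The sign in the exchange relation of two places depends on the larger index only, here [l]. *)
Definition exch l : R[i] := - (-1) ^+ deg m l.

Lemma exch2 l : exch l * exch l = 1.
Proof. by rewrite /exch mulrNN -expr2 sqrr_sign. Qed.

(* Moving c_l^+ to the right past one c_i^+ with i < l. *)
Definition shift l : R[i] := exch l * qpow k (- 1).

Lemma normr_shift l : `|shift l| = 1.
Proof. by rewrite normrM normr_qpow mulr1 normrN normr_sign. Qed.

Lemma shift_neq0 l : shift l != 0.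
Proof. by rewrite -normr_eq0 normr_shift oner_eq0. Qed.

Lemma cl_cl_up i l v : (i < l)%N ->
  cl W true l (cl W true i v) = shift l *: cl W true i (cl W true l v).
Proof.
move=> il; rewrite [in RHS]cl_cl // mulr1 scalerA -/(exch l) mulrACA exch2 mul1r.
by rewrite -qpowD addNr qpow0 scale1r.
Qed.

Lemma cl_iter_up i l (a : nat) v : (i < l)%N ->
  cl W true l (iter a (cl W true i) v) =
  shift l ^+ a *: iter a (cl W true i) (cl W true l v).
Proof.
move=> il; elim: a => [|a IHa] /=; first by rewrite scale1r.
by rewrite cl_cl_up // IHa linearZ /= scalerA exprS.
Qed.

(** The creation operators of the places in [s] over an arbitrary vector, so that a ket can be cut
    at a place [l]. *)
Definition pile r (s : seq I) v : W :=
  foldr (fun i v => iter (r i) (cl W true i) v) v s.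

Lemma iter_cl_linear xi i (a : nat) (x : R[i]) v :
  iter a (cl W xi i) (x *: v) = x *: iter a (cl W xi i) v.
Proof. by elim: a => //= a ->; rewrite linearZ. Qed.

Lemma cl_pile r (s : seq I) l v : all (fun i : I => (i < l)%N) s ->
  cl W true l (pile r s v) =
  shift l ^+ (\sum_(i <- s) r i) *: pile r s (cl W true l v).
Proof.
elim: s => [|i s IHs] /=; first by rewrite big_nil scale1r.
move=> /andP[il sl]; rewrite cl_iter_up // IHs // iter_cl_linear scalerA.
by rewrite big_cons exprD.
Qed.

Lemma enum_ord_split l : exists s1 s2 : seq I,
  [/\ enum 'I_(m + n) = s1 ++ l :: s2, all (fun i : I => (i < l)%N) s1 &
      all (fun i : I => (l < i)%N) s2].
Proof.
exists (take l (enum 'I_(m + n))), (drop l.+1 (enum 'I_(m + n))); split.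
- rewrite -[X in _ = _ ++ X :: _](nth_ord_enum l l) -drop_nth ?cat_take_drop //.
  by rewrite size_enum_ord.
- apply/allP => i /(map_f (@nat_of_ord _)); rewrite map_take val_enum_ord take_iota.
  by rewrite mem_iota; lia.
- apply/allP => i /(map_f (@nat_of_ord _)); rewrite map_drop val_enum_ord drop_iota.
  by rewrite mem_iota; lia.
Qed.

Definition below l r : nat := \sum_(i < m + n | (i < l)%N) r i.

Lemma eq_pile r s (t : seq I) v :
  {in t, r =1 s} -> pile r t v = pile s t v.
Proof.
elim: t => //= i t IHt e; rewrite e ?mem_head // IHt // => j jt.
by rewrite e // inE jt orbT.
Qed.

(** To reach its own power in the ket, $c_l^+$ passes the creation operators of the places before
    [l], at the cost of one factor [shift l] per particle. *)
Lemma cl_ket l r : cl W true l (K r) = shift l ^+ below l r *: K (inc l r).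
Proof.
have [s1 [s2 [es a1 a2]]] := enum_ord_split l.
rewrite /ket es -!/(pile _ _ _) /pile !foldr_cat /= -!/(pile _ _ _).
have -> : below l r = (\sum_(i <- s1) r i)%N.
  transitivity (\sum_(i <- enum 'I_(m + n) | (i < l)%N) r i)%N.
    by rewrite big_enum_cond.
  rewrite es big_cat big_cons ltnn /=.
  rewrite [X in (_ + X)%N]big1_seq ?addn0 //.
    by rewrite [RHS]big_seq [LHS]big_seq_cond; apply: eq_bigl => i;
       case si: (i \in s1) => //=; apply: (allP a1).
  by move=> i /andP[il /(allP a2)]; lia.
rewrite cl_pile //; congr (_ *: _).
rewrite [pile (inc l r) s1 _](eq_pile (s := r)); last first.
  move=> i /(allP a1) il; rewrite ffunE ifN //.
  by apply/eqP => il'; rewrite il' ltnn in il.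
rewrite ffunE eqxx [pile (inc l r) s2 _](eq_pile (s := r)) // => i /(allP a2) il.
by rewrite ffunE ifN //; apply/eqP => il'; rewrite il' ltnn in il.
Qed.

Lemma nb_iter i j (a : nat) v (x : nat) : nb W i v = x%:R *: v ->
  nb W i (iter a (cl W true j) v) = (x + a * (i == j))%:R *: iter a (cl W true j) v.
Proof.
move=> eigv; elim: a => [|a IHa] /=; first by rewrite mul0n addn0.
apply/eqP; rewrite -subr_eq0; apply/eqP.
have /eqP := nb_cl true i j (iter a (cl W true j) v).
rewrite IHa linearZ /= subr_eq -scalerDl => /eqP ->; rewrite mul1r -natrD.
by rewrite mulSn addnCA subrr.
Qed.

Lemma nb_ket i r : nb W i (K r) = (r i)%:R *: K r.
Proof.
suff H (s : seq I) : nb W i (pile r s vac) =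
    (\sum_(j <- s) r j * (i == j))%:R *: pile r s vac.
  rewrite [LHS]H big_enum /= (bigD1 i) //= eqxx muln1 big1 ?addn0 // => j.
  by rewrite eq_sym => /negbTE ->; rewrite muln0.
elim: s => [|j s IHs] /=; first by rewrite nb_vac big_nil scale0r.
by rewrite (nb_iter _ _ IHs) big_cons addnC.
Qed.

Lemma natr_complex (a : nat) : a%:R = (a%:R : R)%:C :> R[i].
Proof. by rewrite rmorph_nat. Qed.

Lemma below_dec l j r : (l <= j)%N -> below l (dec j r) = below l r.
Proof.
move=> lj; apply: eq_bigr => i il; rewrite ffunE ifN //.
by apply/eqP => ij; rewrite ij in il; lia.
Qed.

Lemma linear_one_sub (a : R[i]) i : linear (fun u => u - a *: nb W i u).
Proof.
move=> x u v; rewrite linearP scalerDr !scalerA scalerBr opprD addrACA scalerA.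
by rewrite [a * x]mulrC.
Qed.

Hypothesis hk : (1 < k)%N.

(** On the ket with one particle less, $1-(-1)^{\langle j\rangle}N_j$ takes the value $r_j$ in both
    cases: it is $1+(r_j-1)$ when [j < m], and otherwise exclusion forces $r_j=1$ and it is
    $1-0$. *)
Lemma cl_mp_ket j r : trunc_occ k r -> (0 < r j)%N ->
  cl W false j (cl W true j (K (dec j r))) = (rcq k * qn k (r j))%:C *: K (dec j r).
Proof.
move=> tr rj; rewrite cl_mp.
rewrite (qnum_op_eigen k (linear_one_sub _ j) (x := (r j)%:R)); last first.
  rewrite nb_ket scalerA -[X in X - _]scale1r -scalerBl -natr_complex; congr (_ *: _).
  rewrite ffunE eqxx /deg.
  have rc : (r j <= cap m k j)%N := trunc_occP hk r tr j.
  move: rc; rewrite /cap; case: ifP => jm rc; last first.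
    by have -> : r j = 1%N; [lia | rewrite mulr0 subr0].
  by rewrite expr1 mulN1r opprK -{2}(prednK rj) mulrS.
by rewrite scalerA qnum_nat cq_real -rmorphM.
Qed.

Lemma ket_dec j r : (0 < r j)%N ->
  K r = (shift j ^+ below j r)^-1 *: cl W true j (K (dec j r)).
Proof.
move=> rj; rewrite cl_ket inc_dec // below_dec // scalerA mulVf ?scale1r //.
by rewrite expf_neq0 // shift_neq0.
Qed.

Lemma cl_down_ket j r : trunc_occ k r -> (0 < r j)%N ->
  cl W false j (K r) =
  ((shift j ^+ below j r)^-1 * (rcq k * qn k (r j))%:C) *: K (dec j r).
Proof.
by move=> tr rj; rewrite {1}(ket_dec rj) linearZ /= cl_mp_ket // scalerA.
Qed.

(* The squared norm of the ket r, see dot_ket. *)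
Definition nrm r : R :=
  rcq k ^+ (\sum_i r i) *
  \prod_(i < m + n | (i < m)%N) \prod_(1 <= s < (r i).+1) qn k s.

Lemma nrm_gt0 r : trunc_occ k r -> 0 < nrm r.
Proof.
move=> tr; rewrite mulr_gt0 ?exprn_gt0 ?rcq_gt0 //.
apply: prodr_gt0 => i im; rewrite big_seq; apply: prodr_gt0 => s.
rewrite mem_index_iota => sr; apply: qn_gt0 => //.
by have := trunc_occ_lt hk tr i; lia.
Qed.

Lemma nrm_inc j r : trunc_occ k (inc j r) ->
  nrm (inc j r) = rcq k * qn k (r j).+1 * nrm r.
Proof.
move=> tr; rewrite /nrm sum_inc exprS; set a := rcq k ^+ _.
have [jm|jm] := boolP (j < m)%N; last first.
  (* For [m <= j] the product in [nrm] has no factor at [j]; this agrees with the claim because the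
     place was empty and $[1]=1$. *)
  have -> : qn k (r j).+1 = 1 :> R.
    move: (trunc_occP hk _ tr j); rewrite ffunE eqxx /cap (negbTE jm) ltnS leqn0.
    by move/eqP->; apply: qn1.
  rewrite mulr1 -mulrA; congr (_ * (_ * _)); apply: eq_bigr => i im.
  by rewrite ffunE ifN //; apply/eqP => ij; rewrite -ij im in jm.
rewrite (bigD1 j) //= [in RHS](bigD1 j) //= ffunE eqxx big_nat_recr //=.
rewrite (eq_bigr (fun i => \prod_(1 <= s < (r i).+1) qn k s)); first by ring.
by move=> i /andP[_ /negbTE ij]; rewrite ffunE ij.
Qed.

Lemma nrm_def r :
  cq k ^+ (\sum_i r i) * \prod_(i < m + n | (i < m)%N) qfact k (r i) = (nrm r)%:C.
Proof.
rewrite cq_real rmorphM rmorphXn rmorph_prod; congr (_ * _).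
apply: eq_bigr => i _; rewrite rmorph_prod; apply: eq_bigr => s _.
exact: qnum_nat.
Qed.

End Ladder.

Arguments shift {R m n} k l.
Arguments nrm {R m n} k r.

(** * Orthonormal basis, matrix elements and irreducibility *)

Section FockProduct.
Context {R : realType} {m n k : nat}.
Hypothesis hk : (1 < k)%N.
Context (W : clqModule R m n k) (vac : W) (dot : {dot W for Num.conj}).
Local Notation I := 'I_(m + n).
Local Notation occ := (occ m n).
Local Notation K := (ket vac).
Local Notation B := (nket vac).
Implicit Types (r s t : occ) (i j l : I) (v w : W).

Hypothesis nb_vac : forall i, nb W i vac = 0.
Hypothesis ket0 : forall r, ~~ trunc_occ k r -> K r = 0.
Hypothesis ket_span : forall v, lspan (trunc_occ k) K v.
Hypothesis hdot : is_fock_product vac dot.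

(** The squared norm of $c_j^-K_r$ is $(c_j^+c_j^-K_r,K_r)$, a multiple of $[r_j]=[0]=0$, and the
    scalar product is definite. *)
Lemma cl_down_ket0 j r : r j = 0%N -> cl W false j (K r) = 0.
Proof.
move=> rj; have [_ dot_cl _] := hdot; apply/eqP.
rewrite -(dnorm_eq0 dot) -dot_cl cl_pm.
rewrite (qnum_op_eigen k (x := 0) (linearP (nb W j))); last first.
  by rewrite nb_ket // rj !scale0r.
by rewrite qnum_sin mulr0 mul0r sin0 mul0r scale0r scaler0 linear0l.
Qed.

Lemma dot_natZr (a : nat) u v : dot u (a%:R *: v) = a%:R * dot u v.
Proof. by rewrite linearZr_LR /= rmorph_nat. Qed.

(** The two kets are eigenvectors of a self-adjoint $N_i$ for different real eigenvalues. *)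
Lemma dot_ket_neq r s : r != s -> dot (K r) (K s) = 0.
Proof.
move=> rs; have [_ _ dot_nb] := hdot.
have [i ri] : exists i, r i != s i.
  apply: contrapT => nex; move/eqP: rs; apply; apply/ffunP => i.
  by apply/eqP/negPn/negP => ri; apply: nex; exists i.
have := dot_nb i (K r) (K s); rewrite !nb_ket // dot_natZr linearZl_LR /=.
move/eqP; rewrite -subr_eq0 -mulrBl mulf_eq0 subr_eq0 eqr_nat (negbTE ri).
by move/eqP.
Qed.

(** Induction on the number of particles: up to a phase of modulus 1, $K_r$ is $c_j^+$ of the ket
    with one particle less, and adjointness brings in $c_j^-c_j^+$, of value $c_q[r_j]$. *)
Lemma dot_ket r : trunc_occ k r -> dot (K r) (K r) = (nrm k r)%:C.
Proof.
have [dot_vac dot_cl _] := hdot.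
move: {2}(\sum_i r i)%N (leqnn (\sum_i r i)%N) => a.
elim: a r => [|a IHa] r ra tr.
  have r0 i : r i = 0%N.
    by apply/eqP; rewrite -leqn0 (leq_trans _ ra) // (bigD1 i) //= leq_addr.
  have -> : K r = vac.
    by rewrite /ket; elim: (enum _) => //= i s ->; rewrite r0.
  rewrite dot_vac /nrm big1 // expr0 mul1r big1 // => i _.
  by rewrite r0 big_geq.
have [[j rj]|r0] := pselect (exists j, (0 < r j)%N); last first.
  apply: IHa => //; rewrite big1 // => i _; apply/eqP; rewrite -leqn0 leqNgt.
  by apply/negP => ri; apply: r0; exists i.
have td := dec_trunc hk j tr.
rewrite (ket_dec vac rj) dnormZ normfV normrX normr_shift expr1n invr1 expr1n mul1r.
rewrite dot_cl cl_mp_ket // linearZr_LR /= IHa //; last first.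
  by rewrite -(inc_dec rj) sum_inc in ra.
rewrite conj_Creal ?complex_real ?eqxx // -rmorphM; congr (_%:C).
by rewrite -[in RHS](inc_dec rj) nrm_inc ?inc_dec // ffunE eqxx prednK.
Qed.

Lemma sqrtC_real_complex (x : R) : 0 <= x -> sqrtC (x%:C) = (Num.sqrt x)%:C.
Proof.
by move=> x0; rewrite -{1}(sqr_sqrtr x0) rmorphXn sqrCK // ler0c sqrtr_ge0.
Qed.

Definition nscale r : R := Num.sqrt (nrm k r).

Lemma nscale_gt0 r : trunc_occ k r -> 0 < nscale r.
Proof. by move=> tr; rewrite sqrtr_gt0 nrm_gt0. Qed.

Lemma nketE r : trunc_occ k r -> B r = (nscale r)^-1%:C *: K r.
Proof.
move=> tr; rewrite /nket nrm_def sqrtC_real_complex ?fmorphV //.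
exact/ltW/nrm_gt0.
Qed.

Lemma ket_nket r : trunc_occ k r -> K r = (nscale r)%:C *: B r.
Proof.
move=> tr; rewrite nketE // scalerA -rmorphM divff ?scale1r //.
by rewrite gt_eqF // nscale_gt0.
Qed.

Lemma nket_orthonormal r s : trunc_occ k r -> trunc_occ k s ->
  dot (B r) (B s) = (r == s)%:R.
Proof.
move=> tr ts; rewrite !nketE // linearZr_LR linearZl_LR /=.
rewrite conj_Creal ?complex_real ?eqxx //.
have [<-|rs] := eqVneq r s; last by rewrite dot_ket_neq // !mulr0.
rewrite dot_ket // -!rmorphM /= /nscale.
rewrite -[X in _ * (_ * X)](sqr_sqrtr (ltW (nrm_gt0 hk tr))).
rewrite expr2 mulrA mulrA mulfVK ?mulVf //; by rewrite gt_eqF // nscale_gt0.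
Qed.

Lemma nket_expand v : v = \sum_(r <- states k) dot v (B r) *: B r.
Proof.
have base r : trunc_occ k r ->
    B r = \sum_(s <- states k) dot (B r) (B s) *: B s.
  move=> tr; have rs : r \in states k by rewrite mem_states.
  rewrite (bigD1_seq r) ?states_uniq //= nket_orthonormal // eqxx scale1r.
  rewrite big_seq_cond big1 ?addr0 // => s /andP[].
  rewrite mem_states // eq_sym => ts /negbTE rns.
  by rewrite nket_orthonormal // rns scale0r.
have [s [a [sP ->]]] := ket_span v.
rewrite (eq_big_seq (fun r => (a r * (nscale r)%:C) *: B r)); last first.
  by move=> r /(allP sP) tr; rewrite ket_nket // scalerA.
under [RHS]eq_bigr => r _ do rewrite linear_sumlz scaler_suml.
rewrite exchange_big /=; apply: eq_big_seq => r /(allP sP) tr.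
rewrite {1}(base r tr) scaler_sumr; apply: eq_bigr => t _.
by rewrite [in RHS]linearZl_LR /= scalerA.
Qed.

Lemma nb_nket i r : nb W i (B r) = (r i)%:R *: B r.
Proof. by rewrite linearZ /= nb_ket // scalerA mulrC -scalerA. Qed.

Lemma hop_amplitude_qn j l r :
  hop_amplitude k j l r = (Num.sqrt (qn k (r j) * qn k (r l).+1))%:C :> R[i].
Proof.
congr (Num.sqrt _)%:C; rewrite /qn expr2 mulf_div; congr (_ / _).
Qed.

Lemma sqrt_ratio (a b c : R) : 0 < a -> 0 < b -> 0 < c ->
  (Num.sqrt (a * c))^-1 * a * Num.sqrt (b * c) = Num.sqrt (a * b).
Proof.
move=> a0 b0 c0; rewrite !sqrtrM ?ltW // -[X in _ * X * _](sqr_sqrtr (ltW a0)).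
by field; rewrite !gt_eqF ?sqrtr_gt0.
Qed.

(** Both [r] and [hop j l r] arise from [dec j r] by adding one particle, so their squared norms are
    in the ratio $[r_j]:[r_l+1]$. The extra $[r_j]$ is the one produced by $c_j^-$. *)
Lemma nscale_hop j l r : j != l -> trunc_occ k r -> movable k j l r ->
  (nscale r)^-1 * qn k (r j) * nscale (hop j l r) =
  Num.sqrt (qn k (r j) * qn k (r l).+1).
Proof.
move=> jl tr mv; have th := hop_trunc hk jl tr mv.
have /andP[rj rl] := mv; have td := dec_trunc hk j tr.
have q0 s i : trunc_occ k s -> (0 < s i)%N -> 0 < qn k (s i) :> R.
  by move=> ts si; rewrite qn_gt0 // si (trunc_occ_lt hk ts).
have a0 := q0 _ _ tr rj.
have b0 : 0 < qn k (r l).+1 :> R.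
  have := q0 _ l th; rewrite ffunE eq_sym (negbTE jl) eqxx; exact.
have M0 := nrm_gt0 (R := R) hk td; have c0 := @rcq_gt0 R k hk.
have nr : nrm k r = qn k (r j) * (rcq k * nrm k (dec j r)) :> R.
  have := nrm_inc (R := R) hk (j := j) (r := dec j r).
  by rewrite inc_dec // ffunE eqxx prednK // => -> //; ring.
have nh : nrm k (hop j l r) = qn k (r l).+1 * (rcq k * nrm k (dec j r)) :> R.
  have := nrm_inc (R := R) hk (j := l) (r := dec j r).
  by rewrite -inc_hop // ffunE eq_sym (negbTE jl) => -> //; ring.
by rewrite /nscale nr nh sqrt_ratio // mulr_gt0.
Qed.

(** * Supercommutators as multiples of the transfer of one particle *)

Definition transfer j l v : W := cl W true l (cl W false j v).

Lemma transferZ j l (a : R[i]) v : transfer j l (a *: v) = a *: transfer j l v.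
Proof. by rewrite /transfer !linearZ. Qed.

Lemma transfer_nket0 j l r : j != l -> trunc_occ k r -> ~~ movable k j l r ->
  transfer j l (B r) = 0.
Proof.
move=> jl tr; rewrite nketE // /transfer !linearZ /= /movable negb_and -leqNgt leqn0.
have [/eqP rj _|rj /=] := boolP (r j == 0%N).
  by rewrite cl_down_ket0 // linear0 scaler0.
rewrite -leqNgt => rl; rewrite cl_down_ket // ?lt0n // linearZ /= cl_ket -inc_hop //.
rewrite ket0 ?scaler0 //; apply/negP => /(trunc_occP hk)/(_ l).
by rewrite ffunE eq_sym (negbTE jl) eqxx; lia.
Qed.

Lemma transfer_nket j l r : j != l -> trunc_occ k r -> movable k j l r ->
  transfer j l (B r) =
  ((shift k j ^+ below j r)^-1 * shift k l ^+ below l (dec j r) *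
   cq k * hop_amplitude k j l r) *: B (hop j l r).
Proof.
move=> jl tr mv; have /andP[rj rl] := mv.
(* The target ket is abstracted first, so that unfolding the normalization affects the source
   only. *)
move: (B (hop j l r)) (ket_nket (hop_trunc hk jl tr mv)) => Bh eBh.
rewrite nketE // /transfer !linearZ /= cl_down_ket // linearZ /= cl_ket -inc_hop //.
rewrite eBh.
have -> : hop_amplitude k j l r =
    ((nscale r)^-1)%:C * (qn k (r j))%:C * (nscale (hop j l r))%:C :> R[i].
  by rewrite hop_amplitude_qn -nscale_hop // rmorphM; congr (_ * _); rewrite rmorphM.
rewrite cq_real !scalerA (rmorphM (real_complex R) (rcq k)); congr (_ *: _).
by ring.
Qed.

(** For $j<l$ the product of the two degrees is the degree of $l$, so the sign of the graded
    commutator is the exchange sign and factors out. *)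
Lemma superbracket_lt j l v : (j < l)%N ->
  superbracket (deg m j) (deg m l) (cl W false j) (cl W true l) v =
  (exch l * (1 + qpow k (- 1))) *: transfer j l v.
Proof.
move=> jl; rewrite /superbracket cl_cl // mulN1r -/(exch l) -scalerBl.
congr (_ *: _); rewrite mulrDr mulr1 addrC; congr (_ + _).
rewrite /exch /deg; have [lm|_] := boolP (l < m)%N.
  by rewrite (ltn_trans jl lm).
by rewrite muln0.
Qed.

Lemma superbracket_gt j l v : (l < j)%N ->
  superbracket (deg m j) (deg m l) (cl W false j) (cl W true l) v =
  (exch j * (1 + qpow k 1)) *: transfer j l v.
Proof.
move=> lj; rewrite /superbracket.
have -> : cl W false j (cl W true l v) = (exch j * qpow k 1) *: transfer j l v.
  rewrite /transfer [in RHS]cl_cl // scalerA -/(exch j) mul1r mulrACA exch2.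
  rewrite mul1r -qpowD.
  by rewrite subrr qpow0 scale1r.
rewrite -scalerBl; congr (_ *: _); rewrite mulrDr mulr1 addrC; congr (_ + _).
rewrite /exch /deg; have [jm|_] := boolP (j < m)%N.
  by rewrite (ltn_trans lj jm).
by rewrite mul0n.
Qed.

(** * Signs and phases of the matrix elements *)

Lemma below_split l r j : (j < l)%N ->
  below l r = (below j r + r j + \sum_(i < m + n | (j < i < l)%N) r i)%N.
Proof.
move=> jl; rewrite /below (bigID (fun i : I => (i < j)%N)) /= -addnA; congr (_ + _)%N.
  by apply: eq_bigl => i; apply/andP/idP => [[]//|ij]; split=> //; apply: ltn_trans jl.
rewrite (bigD1 j) /= ?jl ?ltnn //; congr (_ + _)%N; apply: eq_bigl => i.
rewrite -leqNgt -(inj_eq val_inj) /= andbAC ltn_neqAle eq_sym; lia.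
Qed.

Lemma sum_upto j r : (\sum_(i < m + n | (i <= j)%N) r i = below j r + r j)%N.
Proof.
rewrite (bigD1 j) //= addnC; congr (_ + _)%N; apply: eq_bigl => i.
by rewrite -(inj_eq val_inj) /= andbC ltn_neqAle.
Qed.

Lemma sum_from l r j : (j < l)%N ->
  (\sum_(i < m + n | (j <= i < l)%N) r i =
   r j + \sum_(i < m + n | (j < i < l)%N) r i)%N.
Proof.
move=> jl; rewrite (bigD1 j) ?leqnn //; congr (_ + _)%N; apply: eq_bigl => i.
by rewrite -(inj_eq val_inj) /=; lia.
Qed.

Lemma shiftX l (a : nat) : shift k l ^+ a = exch l ^+ a * qpow k (- a%:R) :> R[i].
Proof. by rewrite exprMn qpowMn mulN1r. Qed.

Lemma shiftXV l (a : nat) : shift k l ^- a = exch l ^+ a * qpow k a%:R :> R[i].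
Proof.
rewrite shiftX invfM -qpowN opprK; congr (_ * _); rewrite -exprVn; congr (_ ^+ _).
apply: (mulfI (x := exch l)); rewrite ?exch2 ?divff //;
  by rewrite -normr_eq0 normrN normr_sign oner_eq0.
Qed.

(** For $j<l$ the particle removed at $j$ is one of those that $c_l^+$ passes; this off-by-one is
    absent for $j>l$, by [below_dec]. *)
Lemma below_dec_lt l j r : (j < l)%N -> (0 < r j)%N ->
  below l r = (below l (dec j r)).+1.
Proof.
move=> jl rj; rewrite !(below_split _ jl) below_dec // ffunE eqxx.
have -> : (\sum_(i < m + n | j < i < l) dec j r i =
           \sum_(i < m + n | j < i < l) r i)%N.
  by apply: eq_bigr => i /andP[ji _]; rewrite ffunE ifN // -(inj_eq val_inj) /=; lia.
by lia.
Qed.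

(** The two coefficients of the theorem under one name, so that later arguments need not distinguish
    the order of [j] and [l]. *)
Definition e_coef j l r : R[i] :=
  if (j < l)%N then
    - (1 - (1 - (deg m l)%:R) * (r l)%:R)
    * (-1) ^ (((deg m j)%:Z - (deg m l)%:Z)
                * (\sum_(i < m + n | (i <= j)%N) r i)%:Z
              + (1 - (deg m l)%:Z)
                * (\sum_(i < m + n | (j < i < l)%N) r i)%:Z)
    * expi (- (pi * ((\sum_(i < m + n | (j <= i < l)%N) r i)%:R
                     + (-1) ^+ deg m l * (r l)%:R
                     - 2 * (deg m l)%:R) / k%:R))
    * hop_amplitude k j l r
  else
    - (1 - (1 - (deg m l)%:R) * (r l)%:R)
    * (-1) ^ (((deg m l)%:Z - (deg m j)%:Z)
                * (\sum_(i < m + n | (i <= l)%N) r i)%:Z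
              + (1 - (deg m j)%:Z)
                * (\sum_(i < m + n | (l < i < j)%N) r i)%:Z)
    * expi (pi * ((\sum_(i < m + n | (l <= i < j)%N) r i)%:R
                  + (-1) ^+ deg m j * (r j)%:R) / k%:R)
    * hop_amplitude k j l r.

Lemma movable_target j l r : movable k j l r -> (m <= l)%N -> r l = 0%N.
Proof. by move=> /andP[_]; rewrite /cap ltnNge; case: leqP => //; lia. Qed.

Lemma trunc_source j r : trunc_occ k r -> (0 < r j)%N -> (m <= j)%N -> r j = 1%N.
Proof.
move=> tr rj mj; have := trunc_occP hk r tr j.
by rewrite /cap ltnNge mj /=; lia.
Qed.

Lemma exclusion_factor j l r : movable k j l r ->
  1 - (1 - (deg m l)%:R) * (r l)%:R = 1 :> R[i].
Proof.
move=> mv; rewrite /deg; have [lm|ml] := ltnP l m; first by rewrite subrr mul0r subr0.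
by rewrite (movable_target mv ml) mulr0 subr0.
Qed.

(** If [l < m], all exchange signs are 1. If only [j < m], the particles below [l] count once each.
    If [m <= j], those below [j] count twice and cancel. *)
Lemma sign_lt j l r : (j < l)%N -> trunc_occ k r -> movable k j l r ->
  (-1) ^+ deg m j * exch l * (exch j ^+ below j r * exch l ^+ below l (dec j r)) =
  - (-1) ^ (((deg m j)%:Z - (deg m l)%:Z)
                * (\sum_(i < m + n | (i <= j)%N) r i)%:Z
              + (1 - (deg m l)%:Z)
                * (\sum_(i < m + n | (j < i < l)%N) r i)%:Z) :> R[i].
Proof.
move=> jl tr mv; have /andP[rj _] := mv.
have bl := esym (below_dec_lt jl rj).
rewrite sum_upto; move: bl; rewrite (below_split r jl).
move: (\sum_(i < m + n | _) _)%N => M bl.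
rewrite /exch /deg; have [lm|ml] := ltnP l m.
  by rewrite (ltn_trans jl lm) !subrr expr0z expr1 opprK mulr1 !expr1n !mulr1.
have [jm|mj] := ltnP j m.
  rewrite expr1 opprK expr1n mul1r expr0 mulN1r opprK mul1r.
  rewrite !subr0 !mul1r -PoszD -bl -exprnP exprS mulN1r opprK //.
(* Exclusion gives $r_j=1$, which cancels the off-by-one of [below_dec_lt]. *)
rewrite (trunc_source tr rj mj) in bl.
rewrite !expr0 !subr0 mul0r mul1r add0r mul1r mulN1r -exprnP -exprD.
have -> : (below j r + below l (dec j r) = (below j r).*2 + M)%N by lia.
by rewrite exprD -muln2 mulnC exprM sqrrN expr1n expr1n mul1r.
Qed.

Lemma sign_gt j l r : (l < j)%N -> trunc_occ k r -> movable k j l r ->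
  (-1) ^+ deg m j * exch j * (exch j ^+ below j r * exch l ^+ below l (dec j r)) =
  - (-1) ^ (((deg m l)%:Z - (deg m j)%:Z)
                * (\sum_(i < m + n | (i <= l)%N) r i)%:Z
              + (1 - (deg m j)%:Z)
                * (\sum_(i < m + n | (l < i < j)%N) r i)%:Z) :> R[i].
Proof.
move=> lj tr mv; rewrite below_dec 1?ltnW // sum_upto (below_split r lj).
move: (\sum_(i < m + n | _) _)%N => M.
rewrite /exch /deg; have [jm|mj] := ltnP j m.
  by rewrite (ltn_trans lj jm) !subrr expr0z expr1 opprK mulr1 !expr1n !mulr1.
have [lm|ml] := ltnP l m.
  by rewrite !expr0 expr1 opprK expr1n !subr0 !mul1r mulr1 mulN1r -PoszD.
rewrite (movable_target mv ml) addn0 !expr0 !subr0 mul0r mul1r add0r mul1r.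
rewrite mulN1r -exprnP -exprD.
have -> : (below l r + M + below l r = (below l r).*2 + M)%N by lia.
by rewrite exprD -muln2 mulnC exprM sqrrN expr1n expr1n mul1r.
Qed.

Lemma linear_nb_affine (a b : R[i]) i : linear (fun u => a *: nb W i u - b *: u).
Proof. exact: (linearP ((a \*: nb W i) \- (b \*: idfun))). Qed.

Lemma linear_nb_shifted (a b : R[i]) i :
  linear (fun u => - (a *: nb W i u - b *: u) - u).
Proof. exact: (linearP ((\- ((a \*: nb W i) \- (b \*: idfun))) \- idfun)). Qed.

Lemma nb_affine_eigen l r : (-1) ^+ deg m l *: nb W l (B r) - 2^-1 *: B r =
  ((-1) ^+ deg m l * (r l)%:R - 2^-1 : R)%:C *: B r.
Proof.
rewrite nb_nket scalerA -scalerBl; congr (_ *: _).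
by rewrite rmorphB rmorphM rmorphXn rmorphN1 rmorph_nat fmorphV rmorph_nat.
Qed.

Lemma nb_shifted_eigen l r :
  - ((-1) ^+ deg m l *: nb W l (B r) - 2^-1 *: B r) - B r =
  (- ((-1) ^+ deg m l * (r l)%:R - 2^-1) - 1 : R)%:C *: B r.
Proof.
rewrite nb_affine_eigen -scaleNr -[X in _ - X]scale1r -scalerBl.
by rewrite -rmorphN -(rmorph1 (real_complex R)) -rmorphB.
Qed.

(** An empty source gives $[0]=0$; a full target gives $[k]=0$ when [l < m] and the exclusion factor
    $1-r_l=0$ otherwise. The matrix element formula thus holds even where [hop j l r] describes no
    admissible state. *)
Lemma e_coef_unmovable j l r : trunc_occ k r -> ~~ movable k j l r ->
  e_coef j l r = 0.
Proof.
move=> tr nm.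
suff : (1 - (1 - (deg m l)%:R) * (r l)%:R) * hop_amplitude k j l r = 0 :> R[i].
  by rewrite /e_coef; case: ifP => _ /eqP;
     rewrite mulf_eq0 => /orP[] /eqP e0; rewrite e0 ?oppr0 ?mulr0 ?mul0r.
rewrite hop_amplitude_qn; move: nm; rewrite /movable negb_and -!leqNgt leqn0.
case/orP => [/eqP ->|lr]; first by rewrite qn0 mul0r sqrtr0 mulr0.
move: lr (trunc_occP hk r tr l); rewrite /cap /deg; case: ltnP => _ lr rl.
  by rewrite (_ : (r l).+1 = k) ?qnk ?mulr0 ?sqrtr0 ?mulr0 //; lia.
by rewrite (_ : r l = 1%N) ?subr0 ?mul1r ?subrr ?mul0r //; lia.
Qed.

Lemma hop_amplitude_neq0 j l r : j != l -> trunc_occ k r -> movable k j l r ->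
  hop_amplitude k j l r != 0 :> R[i].
Proof.
move=> jl tr mv; rewrite hop_amplitude_qn -nscale_hop // fmorph_eq0.
have /andP[rj _] := mv.
have th := hop_trunc hk jl tr mv.
apply: mulf_neq0; last by rewrite gt_eqF ?nscale_gt0.
apply: mulf_neq0; first by rewrite invr_eq0 gt_eqF ?nscale_gt0.
by rewrite gt_eqF // qn_gt0 // rj trunc_occ_lt.
Qed.

Lemma e_coef_neq0 j l r : j != l -> trunc_occ k r ->
  (e_coef j l r != 0) = movable k j l r.
Proof.
move=> jl tr; have [mv|nm] := boolP (movable k j l r); last first.
  by rewrite e_coef_unmovable ?eqxx.
have ne (x : R) : expi x != 0 by rewrite -normr_eq0 normr_expi oner_eq0.
rewrite /e_coef (exclusion_factor mv).
by case: ifP => _; rewrite !mulf_neq0 ?hop_amplitude_neq0 ?ne ?expfz_neq0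
  ?oppr_eq0 ?oner_eq0.
Qed.

Lemma qpow_expi (x : R) : expi (pi * x / k%:R) = qpow k x.
Proof. by []. Qed.

Lemma qpow_expiN (x : R) : expi (- (pi * x / k%:R)) = qpow k (- x).
Proof. by rewrite /qpow mulrN mulNr. Qed.

(** The power of $q$ in [rho_e] acts after the hop and sees $r_l+1$, while $c_l^+$ passes one
    particle fewer. These two units add up when $\langle l\rangle=1$ and cancel when $\langle
    l\rangle=0$, whence the term $2\langle l\rangle$. *)
Lemma phase_lt j l r : (j < l)%N -> (0 < r j)%N ->
  - ((\sum_(i < m + n | (j <= i < l)%N) r i)%:R + (-1) ^+ deg m l * (r l)%:R -
     2 * (deg m l)%:R) =
  - ((-1) ^+ deg m l * (r l).+1%:R - 2^-1) - 1 + 1 - 2^-1 +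
  ((below j r)%:R - (below l (dec j r))%:R) :> R.
Proof.
move=> jl rj; have := below_dec_lt jl rj; rewrite (below_split r jl).
move/(congr1 (fun a => a%:R : R)); rewrite sum_from //.
rewrite -[(below l _).+1]addn1 -[(r l).+1]addn1 !natrD.
rewrite /deg; move: (\sum_(i < m + n | _) _)%N%:R (below j r)%:R (r j)%:R (r l)%:R.
move: (below l (dec j r))%:R => B M a b c.
by case: (l < m)%N; rewrite ?expr1 ?expr0 /=; lra.
Qed.

Lemma phase_gt j l r : (l < j)%N ->
  (\sum_(i < m + n | (l <= i < j)%N) r i)%:R + (-1) ^+ deg m j * (r j)%:R =
  (-1) ^+ deg m j * (r j)%:R - 2^-1 + 2^-1 +
  ((below j r)%:R - (below l (dec j r))%:R) :> R.
Proof.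
move=> lj; rewrite below_dec ?(ltnW lj) // (below_split r lj) sum_from // !natrD.
move: (_ * _) (\sum_(i < m + n | _) _)%N%:R (below l r)%:R (r l)%:R => x M a b.
lra.
Qed.

Lemma rho_e_lt j l r : (j < l)%N -> trunc_occ k r ->
  rho_e j l (B r) = e_coef j l r *: B (hop j l r).
Proof.
move=> jl tr; have njl : j != l by rewrite -(inj_eq val_inj) ltn_eqF.
rewrite /rho_e jl superbracket_lt // ![in LHS]scalerA.
have [mv|nm] := boolP (movable k j l r); last first.
  rewrite e_coef_unmovable // transfer_nket0 // scale0r.
  (* The linearity of [qpow_op] comes later; its value at 0 is found by treating 0 as an eigenvector
     of value 0. *)
  by rewrite (qpow_op_eigenZ k (linear_nb_shifted _ _ _) (x := 0)) ?scaler0 //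
     linear0 !scaler0 !subr0 oppr0.
have /andP[rj rl] := mv.
rewrite transfer_nket // [in LHS]scalerA.
rewrite (qpow_op_eigenZ k (linear_nb_shifted _ _ _) _ (nb_shifted_eigen _ _)).
rewrite [in LHS]scalerA; congr (_ *: _).
rewrite /e_coef jl (exclusion_factor mv) mulN1r -sign_lt // qpow_expiN.
rewrite ffunE eq_sym (negbTE njl) eqxx shiftXV shiftX.
set S1 := exch j ^+ _; set S2 := exch l ^+ _; set h := hop_amplitude _ _ _ _.
set x := - _ - 1; set y := - (_ - 2 * _).
have -> : qpow k y = qpow k x * qpow k 1 * (2^-1 * cq k * (1 + qpow k (- 1))) *
    (qpow k (below j r)%:R * qpow k (- (below l (dec j r))%:R)) :> R[i].
  rewrite cq_half_down // -!qpowD; congr qpow.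
  exact: phase_lt.
by rewrite -/S1; ring.
Qed.

Lemma rho_e_gt j l r : (l < j)%N -> trunc_occ k r ->
  rho_e j l (B r) = e_coef j l r *: B (hop j l r).
Proof.
move=> lj tr; have njl : j != l by rewrite -(inj_eq val_inj) gtn_eqF.
rewrite /rho_e ltnNge ltnW //=.
rewrite (qpow_op_eigen k (linear_nb_affine _ _ _) (nb_affine_eigen _ _)).
rewrite superbracket_gt // transferZ ![in LHS]scalerA.
have [mv|nm] := boolP (movable k j l r); last first.
  by rewrite e_coef_unmovable // transfer_nket0 // scale0r scaler0.
rewrite transfer_nket // [in LHS]scalerA; congr (_ *: _).
rewrite /e_coef ltnNge ltnW //= (exclusion_factor mv) mulN1r -sign_gt // qpow_expi.
rewrite shiftXV shiftX.
set S1 := exch j ^+ _; set S2 := exch l ^+ _; set h := hop_amplitude _ _ _ _.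
set x := _ - 2^-1; set y := _%:R + _ * _.
have -> : qpow k y = qpow k x * (2^-1 * cq k * (1 + qpow k 1)) *
    (qpow k (below j r)%:R * qpow k (- (below l (dec j r))%:R)) :> R[i].
  rewrite cq_half_up // -!qpowD; congr qpow.
  exact: phase_gt.
by rewrite -/S1; ring.
Qed.

(** * Coordinates of the operators in the orthonormal basis *)

Lemma dot_linearl w (a : R[i]) u v : dot (a *: u + v) w = a * dot u w + dot v w.
Proof. by rewrite linearDl linearZl_LR. Qed.

Lemma dot_suml w (J : Type) (s : seq J) (a : J -> R[i]) (e : J -> W) :
  dot (\sum_(i <- s) a i *: e i) w = \sum_(i <- s) a i * dot (e i) w.
Proof. by rewrite linear_sumlz; apply: eq_bigr => i _; rewrite linearZl_LR. Qed.

(** Linearity is invisible in a definition by choice; it appears once vectors are expanded in an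
    orthonormal basis of eigenvectors. *)
Lemma qpow_op_linear A (linA : linear A) (x : occ -> R) :
  (forall r, trunc_occ k r -> A (B r) = (x r)%:C *: B r) -> linear (qpow_op k A).
Proof.
move=> eigA.
have E v : qpow_op k A v =
    \sum_(r <- states k) dot v (B r) *: (qpow k (x r) *: B r).
  rewrite {1}(nket_expand v).
  have := qpow_opE k linA (s := [seq (x r, dot v (B r) *: B r) | r <- states k]).
  rewrite !big_map /= => ->.
    by apply: eq_bigr => r _; rewrite scalerA mulrC -scalerA.
  move=> _ /mapP[r + ->] /=; rewrite mem_states // => tr.
  have := linA (dot v (B r)) (B r) 0; rewrite (linear_fun0 linA) !addr0 => ->.
  by rewrite eigA // [in LHS]scalerA mulrC -scalerA.
move=> a u v; rewrite !E scaler_sumr -big_split /=; apply: eq_bigr => r _.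
by rewrite dot_linearl scalerDl [in RHS]scalerA.
Qed.

Lemma superbracket_linear (da db : nat) j l :
  linear (superbracket da db (cl W false j) (cl W true l)).
Proof.
exact: (linearP ((cl W false j \o cl W true l) \-
  ((-1) ^+ (da * db) \*: (cl W true l \o cl W false j)))).
Qed.

Lemma rho_e_linear j l : linear (rho_e j l : W -> W).
Proof.
rewrite /rho_e; case: ifP => _; apply: linear_fun_scale.
  apply: (linear_fun_comp (f := qpow_op _ _)).
    exact: (qpow_op_linear (linear_nb_shifted _ _ _) (fun r _ => nb_shifted_eigen l r)).
  exact/linear_fun_scale/superbracket_linear.
apply: (linear_fun_comp (f := superbracket _ _ _ _)); first exact: superbracket_linear.
exact: (qpow_op_linear (linear_nb_affine _ _ _) (fun r _ => nb_affine_eigen j r)).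
Qed.

Lemma rho_e_nket j l r : j != l -> trunc_occ k r ->
  rho_e j l (B r) = e_coef j l r *: B (hop j l r).
Proof.
rewrite -(inj_eq val_inj) neq_ltn => /orP[jl|lj] tr; first exact: rho_e_lt.
exact: rho_e_gt.
Qed.

Lemma dot_rho_e j l v t : j != l -> trunc_occ k t ->
  dot (rho_e j l v) (B t) =
  \sum_(r <- states k) dot v (B r) * (e_coef j l r * (hop j l r == t)%:R).
Proof.
move=> jl tt; rewrite {1}(nket_expand v) (linear_fun_sum (@rho_e_linear j l)) dot_suml.
apply: eq_big_seq => r; rewrite mem_states // => tr.
rewrite rho_e_nket // -[in LHS](addr0 (_ *: _)) dot_linearl linear0l addr0.
have [mv|nm] := boolP (movable k j l r); last first.
  by rewrite e_coef_unmovable // !mul0r !mulr0.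
by rewrite nket_orthonormal // hop_trunc.
Qed.

Lemma dot_nb i v r : dot (nb W i v) (B r) = (r i)%:R * dot v (B r).
Proof. by have [_ _ ->] := hdot; rewrite nb_nket dot_natZr. Qed.

(** * The orthonormal basis and the layers *)

Lemma nket_lbasis : lbasis (trunc_occ k) B.
Proof.
split=> [v|s a us sP sum0 r rs].
  exists (states k), (fun r => dot v (B r)); split; last exact: nket_expand.
  by apply/allP => r; rewrite mem_states.
have := congr1 (dot^~ (B r)) sum0; rewrite dot_suml linear0l (bigD1_seq r) //=.
rewrite nket_orthonormal ?(allP sP) // eqxx mulr1 big_seq_cond big1 ?addr0 //.
move=> t /andP[/(allP sP) tt]; rewrite nket_orthonormal //; last exact: allP rs.
by case: (t == r); rewrite // mulr0.
Qed.

(** A layer is the orthogonal complement of the basis vectors of other totals, so membership becomes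
    the vanishing of coordinates. *)
Lemma fock_layerP (a : nat) v : fock_layer (k := k) vac a v <->
  forall r, trunc_occ k r -> (\sum_i r i)%N != a -> dot v (B r) = 0.
Proof.
split=> [[s [c [sP ->]]] r tr ra|v0].
  rewrite dot_suml big_seq big1 // => t /(allP sP) /andP[tt /eqP ta].
  rewrite nket_orthonormal //; have [tr'|_] := eqVneq; last by rewrite mulr0.
  by rewrite -tr' ta eqxx in ra.
exists [seq r : occ <- states k | (\sum_i r i)%N == a], (fun r => dot v (B r)); split.
  by apply/allP => r; rewrite mem_filter mem_states // inE /= andbC.
rewrite big_filter [LHS]nket_expand [RHS]big_mkcond; apply: eq_big_seq => r.
rewrite mem_states // => tr; case: ifPn => // ra.
by rewrite v0 // scale0r.
Qed.

Lemma fock_layer_nket (a : nat) r :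
  trunc_occ k r -> (\sum_i r i)%N = a -> fock_layer (k := k) vac a (B r).
Proof.
move=> tr ra; apply/fock_layerP => t tt ta; rewrite nket_orthonormal //.
by have [rt|//] := eqVneq; rewrite -rt ra eqxx in ta.
Qed.

Lemma dot_sub v i r a w : dot (- nb W i v - a *: w) (B r) =
  - dot (nb W i v) (B r) - a * dot w (B r).
Proof. by rewrite linearBl linearNl linearZl_LR. Qed.

Lemma fock_layer_submodule (a : nat) : submodule (fock_layer (k := k) vac a).
Proof.
split.
- split=> [|c u v]; rewrite !inE.
    by apply/fock_layerP => r _ _; rewrite linear0l.
  move=> /fock_layerP u0 /fock_layerP v0.
  by apply/fock_layerP => r tr ra; rewrite dot_linearl u0 // v0 // addr0 mulr0.
- move=> j l v jl /fock_layerP v0; apply/fock_layerP => t tt ta.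
  rewrite dot_rho_e // big_seq big1 // => r; rewrite mem_states // => tr.
  have [mv|nm] := boolP (movable k j l r); last first.
    by rewrite e_coef_unmovable // mul0r mulr0.
  have [ht|_] := eqVneq (hop j l r) t; last by rewrite !mulr0.
  rewrite v0 ?mul0r //; move: ta; rewrite -ht sum_hop //.
  by case/andP: mv.
- move=> j v /fock_layerP v0; apply/fock_layerP => r tr ra.
  by rewrite dot_sub !dot_nb v0 // !mulr0 oppr0 addr0.
Qed.

Lemma nket_ext u v :
  (forall r, trunc_occ k r -> dot u (B r) = dot v (B r)) -> u = v.
Proof.
move=> uv; rewrite [LHS]nket_expand [RHS]nket_expand; apply: eq_big_seq => r.
by rewrite mem_states // => tr; rewrite uv.
Qed.

(** * Supports of vectors and submodules of a layer *)

Definition supp v : seq occ := [seq r <- states k | dot v (B r) != 0].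

Lemma mem_supp v r : (r \in supp v) = (dot v (B r) != 0) && trunc_occ k r.
Proof. by rewrite mem_filter mem_states. Qed.

Lemma supp_uniq v : uniq (supp v).
Proof. exact/filter_uniq/states_uniq. Qed.

Lemma dot_rho_e_hop j l v r : j != l -> trunc_occ k r -> movable k j l r ->
  dot (rho_e j l v) (B (hop j l r)) = dot v (B r) * e_coef j l r.
Proof.
move=> jl tr mv; have rs : r \in states k by rewrite mem_states.
rewrite dot_rho_e ?hop_trunc // (bigD1_seq r) ?states_uniq //= eqxx mulr1.
rewrite big_seq_cond big1 ?addr0 // => t /andP[]; rewrite mem_states // => tt ntr.
have [mt|nm] := boolP (movable k j l t); last first.
  by rewrite e_coef_unmovable // mul0r mulr0.
have [ht|_] := eqVneq (hop j l t) (hop j l r); last by rewrite !mulr0.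
case/andP: mv mt => rj _ /andP[tj _].
by rewrite (hop_inj jl tj rj ht) eqxx in ntr.
Qed.

(** The new support lies in the image of the movable kets: it never grows, and it shrinks as soon as
    one ket cannot move. *)
Lemma size_supp_rho_e j l v : j != l ->
  (size (supp (rho_e j l v)) <= count (movable k j l) (supp v))%N.
Proof.
move=> jl; rewrite -size_filter -[X in (_ <= X)%N](size_map (hop j l)).
apply: uniq_leq_size; first exact: supp_uniq.
move=> t; rewrite mem_supp => /andP[+ tt]; apply: contraNT => tn.
rewrite dot_rho_e // big_seq big1 // => r; rewrite mem_states // => tr.
have [mv|nm] := boolP (movable k j l r); last first.
  by rewrite e_coef_unmovable // mul0r mulr0.
have [ht|_] := eqVneq (hop j l r) t; last by rewrite !mulr0.
have [->|v0] := eqVneq (dot v (B r)) 0; first by rewrite mul0r.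
by case/negP: tn; rewrite -ht map_f // mem_filter mv mem_supp v0.
Qed.

Section Submodules.
Variables (T : set W) (a : nat).
Hypothesis subT : submodule T.
Hypothesis T_layer : T `<=` fock_layer (k := k) vac a.

Lemma submodule_scale (c : R[i]) v : T v -> T (c *: v).
Proof.
have [[T0 linT] _ _] := subT.
move=> Tv; have := linT c v 0; rewrite !inE addr0 in T0 *; exact.
Qed.

Lemma submodule_sum (J : eqType) (s : seq J) (F : J -> W) :
  (forall x, x \in s -> T (F x)) -> T (\sum_(x <- s) F x).
Proof.
have [[T0 linT] _ _] := subT; move=> TF; rewrite big_seq; apply: big_ind => //.
  by rewrite inE in T0.
by move=> u v Tu Tv; have := linT 1 u v; rewrite !inE scale1r; apply.
Qed.

Lemma submodule_nket_hop j l r : j != l -> trunc_occ k r -> movable k j l r ->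
  T (B r) -> T (B (hop j l r)).
Proof.
move=> jl tr mv Tr; have [_ Te _] := subT.
have := Te j l _ jl Tr; rewrite rho_e_nket //.
move/(submodule_scale (e_coef j l r)^-1); rewrite [X in T X]scalerA mulVf ?scale1r //.
by rewrite e_coef_neq0.
Qed.

(** Induction on the total excess of [r] over [s], with truncated subtraction: a hop from an excess
    to a deficit lowers it by one and creates no excess at the target. *)
Lemma submodule_nket_all r s : trunc_occ k r -> trunc_occ k s ->
  (\sum_i r i = \sum_i s i)%N -> T (B r) -> T (B s).
Proof.
move: {2}(\sum_i (r i - s i))%N (leqnn (\sum_i (r i - s i))%N) => d.
elim: d r => [|d IHd] r rd tr ts ers Tr; have [<-//|rs] := eqVneq r s;
  have [j [l [jl sj rl mv]]] := occ_neq_hop hk tr ts ers rs.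
  by move: rd; rewrite (bigD1 j) //=; lia.
apply: (IHd (hop j l r)); rewrite ?hop_trunc //; last exact: submodule_nket_hop.
  rewrite -ltnS (leq_trans _ rd) // (bigD1 j) //= [X in (_ < X)%N](bigD1 j) //=.
  rewrite ffunE eqxx -addSn leq_add //; first lia.
  apply: leq_sum => i ij; rewrite ffunE (negbTE ij).
  by case: eqP => [->|//]; lia.
by rewrite sum_hop //; lia.
Qed.

(* If r and s are in the support of v with s_j < r_j and r_l < s_l, then       *)
(* iterating e_jl exhausts s before r: this makes the support smaller without *)
(* killing v.                                                                 *)
Lemma submodule_has_nket v : T v -> v != 0 -> exists2 r, trunc_occ k r & T (B r).
Proof.
have [_ Te _] := subT.
have [N vN] := ubnP (size (supp v)); elim: N v vN => // N IHN v vN Tv v0.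
have step j l u r s : j != l -> T u -> (size (supp u) <= N)%N ->
    r \in supp u -> s \in supp u -> (s j < r j)%N -> (r l < s l)%N ->
    exists2 r, trunc_occ k r & T (B r).
  move=> jl; have [b sb] := ubnP (s j).
  elim: b u r s sb => // b IHb u r s sb Tu uN ru su srj rsl.
  move: (ru) (su); rewrite !mem_supp => /andP[r0 tr] /andP[s0 ts].
  have Tw := Te j l _ jl Tu; have suppw := size_supp_rho_e u jl.
  have supp_hop t : t \in supp u -> movable k j l t ->
      hop j l t \in supp (rho_e j l u).
    rewrite !mem_supp => /andP[t0 tt] mt.
    by rewrite hop_trunc // andbT dot_rho_e_hop // mulf_neq0 // e_coef_neq0.
  (* Place [j] is occupied since $s_j<r_j$, and [l] has room since $r_l<s_l$ is within capacity. *)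
  have mr : movable k j l r.
    have cs := trunc_occP hk s ts l.
    by rewrite /movable (leq_ltn_trans _ srj) // (leq_trans rsl).
  have hr := supp_hop r ru mr; have [ms|ns] := boolP (movable k j l s).
    apply: (IHb (rho_e j l u) (hop j l r) (hop j l s)) => //; rewrite ?supp_hop //.
    - by case/andP: ms; rewrite ffunE eqxx; lia.
    - exact: leq_trans suppw (leq_trans (count_size _ _) uN).
    - by case/andP: ms; rewrite !ffunE eqxx; lia.
    - by rewrite !ffunE eq_sym (negbTE jl) eqxx; lia.
  (* Here [s] is empty at [j] or full at [l], so it is lost; the image of [r] keeps the vector
     nonzero, and the induction on the size of the support applies. *)
  apply: IHN Tw _.
    apply: leq_ltn_trans suppw _; apply: leq_trans uN.
    rewrite ltn_neqAle count_size andbT -all_count.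
    by apply/negP => /allP/(_ _ su); apply/negP.
  by apply: contraTneq hr => ->; rewrite mem_supp linear0l eqxx.
(* An empty support means $v=0$, a single ket means that $v$ is a multiple of it, and two kets have
   the same total and can be separated. *)
have suppP := nket_expand v; case es : (supp v) => [|r [|s t]].
- case/eqP: v0; apply: nket_ext => r tr; rewrite linear0l; apply/eqP.
  by apply: contraT => r0; have := mem_supp v r; rewrite es r0 tr.
- have : r \in supp v by rewrite es mem_head.
  rewrite mem_supp => /andP[r0 tr]; exists r => //.
  have -> : B r = (dot v (B r))^-1 *: v.
    apply: nket_ext => s ts; rewrite [RHS]linearZl_LR /= nket_orthonormal //.
    have [<-|rs] := eqVneq r s; first by rewrite mulVf.
    apply/esym/eqP; rewrite mulf_eq0; apply/orP; right.
    apply: contraT => s0; have : s \in supp v by rewrite mem_supp s0.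
    by rewrite es inE eq_sym (negbTE rs).
  exact: submodule_scale.
have ru : r \in supp v by rewrite es mem_head.
have su : s \in supp v by rewrite es !inE eqxx orbT.
have := supp_uniq v; rewrite es /= inE negb_or => /andP[/andP[rs _] _].
move: (ru) (su); rewrite !mem_supp => /andP[r0 tr] /andP[s0 ts].
have /fock_layerP va := T_layer Tv.
have sum_a t0 : trunc_occ k t0 -> dot v (B t0) != 0 -> (\sum_i t0 i)%N = a.
  by move=> tt; apply: contraNeq => ta; rewrite va.
have [|j [l [jl sj rl _]]] := occ_neq_hop hk tr ts _ rs; first by rewrite !sum_a.
exact: (step j l v r s).
Qed.

Lemma submodule_full : (exists2 v, T v & v != 0) -> T = fock_layer (k := k) vac a.
Proof.
move=> [v Tv v0]; have [r tr Tr] := submodule_has_nket Tv v0.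
have ra : (\sum_i r i)%N = a.
  apply/eqP; apply: contraT => ra; have /fock_layerP/(_ r tr ra) := T_layer Tr.
  by rewrite nket_orthonormal // eqxx => /eqP; rewrite oner_eq0.
apply/seteqP; split=> // u /fock_layerP ua; rewrite (nket_expand u).
apply: submodule_sum => s; rewrite mem_states // => ts.
have [sa|sa] := eqVneq (\sum_i s i)%N a.
  apply: submodule_scale; apply: submodule_nket_all tr ts _ Tr; by rewrite ra sa.
by rewrite ua // scale0r -(scale0r v); apply: submodule_scale.
Qed.

End Submodules.

Lemma nket_neq0 r : trunc_occ k r -> B r <> 0.
Proof.
move=> tr r0; have := nket_orthonormal tr tr; rewrite {1}r0 linear0l eqxx.
by move/esym/eqP; rewrite oner_eq0.
Qed.

Lemma fock_layer_irreducible (a : nat) : (a <= m * (k - 1) + n)%N ->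
  irreducible_submodule (fock_layer (k := k) vac a).
Proof.
move=> aM; split; first exact: fock_layer_submodule.
  have [r tr ra] := trunc_sum_surj hk aM; move=> l0.
  by have := fock_layer_nket tr ra; rewrite l0 => /(nket_neq0 tr).
move=> T subT Tl; have [[v [Tv v0]]|T0] := pselect (exists v, T v /\ v != 0).
  by right; apply: submodule_full => //; exists v.
left; apply/seteqP; split=> [v Tv /=|_ ->].
  by apply/eqP; apply: contrapT => /negP v0; apply: T0; exists v.
by have [[+ _] _ _] := subT; rewrite inE.
Qed.

(** * Decomposition into layers *)

Definition layer_part (a : nat) v : W :=
  \sum_(r <- states k | (\sum_i r i)%N == a) dot v (B r) *: B r.

Lemma dot_layer_part (a : nat) v r : trunc_occ k r ->
  dot (layer_part a v) (B r) = if (\sum_i r i)%N == a then dot v (B r) else 0.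
Proof.
move=> tr; have rs : r \in states k by rewrite mem_states.
have coord c t : trunc_occ k t -> dot (c *: B t) (B r) = c * (t == r)%:R.
  by move=> tt; rewrite linearZl_LR /= nket_orthonormal.
rewrite /layer_part linear_sumlz big_mkcond (bigD1_seq r) ?states_uniq //=.
rewrite coord // eqxx mulr1 [X in _ + X = _]big1_seq ?addr0 // => t /andP[tr'].
rewrite mem_states // => tt; case: ifP => // _.
by rewrite coord // (negbTE tr') mulr0.
Qed.

Lemma fock_layer_direct_sum :
  direct_sum (fun a : 'I_(m * (k - 1) + n).+1 => fock_layer (k := k) vac a).
Proof.
move=> v; exists [ffun a : 'I_(m * (k - 1) + n).+1 => layer_part a v]; split.
  split=> [a|].
    by rewrite ffunE; apply/fock_layerP => r tr ra; rewrite dot_layer_part // ifN.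
  apply: nket_ext => r tr; rewrite linear_sumlz.
  have rM : (\sum_i r i < (m * (k - 1) + n).+1)%N by rewrite ltnS sum_trunc_le.
  rewrite (bigD1 (Ordinal rM)) //= ffunE dot_layer_part // eqxx.
  rewrite big1 ?addr0 // => a ar; rewrite ffunE dot_layer_part // ifN //.
  by apply: contraNneq ar => ra; apply/eqP/val_inj.
move=> f [fl vE]; apply/ffunP => a; rewrite ffunE; apply: nket_ext => r tr.
rewrite dot_layer_part //; have [ra|ra] := eqVneq (\sum_i r i)%N a; last first.
  by have /fock_layerP -> := fl a.
rewrite vE linear_sumlz (bigD1 a) //= big1 ?addr0 // => b ba.
have /fock_layerP -> // := fl b.
by rewrite ra; apply: contraNneq ba => ab; apply/eqP/val_inj.
Qed.

Lemma rho_H_nket (j : 'I_(m + n).-1) r : rho_H j (B r) =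
  (- ((r (ord_first j))%:R + (-1) ^+ deg m (ord_next j) * (r (ord_next j))%:R)) *: B r.
Proof.
rewrite /rho_H !nb_nket [in X in _ - X]scalerA -scaleNr -scaleNr -scalerDl.
by rewrite -opprD.
Qed.

End FockProduct.

(** * Descent from the Fock space to its quotient *)

Section Truncation.
Context {R : realType} {m n k : nat}.
Local Notation I := 'I_(m + n).
Local Notation occ := (occ m n).

Lemma ket_exclusion (W : clqModule R m n k) (vac : W) (r : occ) :
  ~~ fock_occ r -> ket vac r = 0.
Proof.
rewrite /fock_occ negb_forall; case/existsP => i; rewrite negb_imply -ltnNge.
case/andP => mi ri; rewrite /ket; have : i \in enum 'I_(m + n) by rewrite mem_enum.
have iter0 a j : iter a (cl W true j) 0 = 0 by elim: a => //= a ->; rewrite linear0.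
elim: (enum _) => //= j s IHs; rewrite inE => /orP[/eqP <-|/IHs ->]; last exact: iter0.
by rewrite -(subnKC ri) addnC iterD [iter 2 _ _]/= cl_sq // iter0.
Qed.

Context (F W : clqModule R m n k) (vac : F) (p : {linear F -> W}).
Hypothesis hW : is_truncation vac p.

Lemma truncation_ket (r : occ) : p (ket vac r) = ket (p vac) r.
Proof.
have [pcl _ _ _] := hW; rewrite /ket; elim: (enum _) => //= i s <-.
by elim: (r i) => //= a <-; rewrite pcl.
Qed.

(** Either exclusion is violated and the ket vanishes by $(c_i^+)^2=0$, or some $r_i\ge k$ with
    [i < m] and it is the image of a vector of the ideal. *)
Lemma truncation_ket0 (r : occ) : ~~ trunc_occ k r -> ket (p vac) r = 0.
Proof.
rewrite /trunc_occ; have [fr|nf _] := boolP (fock_occ r); last exact: ket_exclusion.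
rewrite /= negb_forall; case/existsP => i; rewrite negb_imply -leqNgt => ri.
have [_ _ _ kerp] := hW; rewrite -truncation_ket; apply/kerp.
exists [:: r], (fun=> 1); rewrite big_seq1 scale1r /= fr andbT; split=> //.
by apply/existsP; exists i.
Qed.

Lemma truncation_nb_vac : is_fock vac -> forall i, nb W i (p vac) = 0.
Proof.
by move=> [_ nb0 _] i; have [_ pnb _ _] := hW; rewrite -pnb nb0 linear0.
Qed.

Lemma truncation_ket_span :
  is_fock vac -> forall w, lspan (trunc_occ k) (ket (p vac)) w.
Proof.
move=> [_ _ [spanF _]] w; have [_ _ surj _] := hW.
have [v <-] := surj w; have [s [a [_ ->]]] := spanF v.
exists [seq r <- s | trunc_occ k r], a; split; first exact: filter_all.
rewrite linear_sum big_filter [RHS]big_mkcond; apply: eq_bigr => r _.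
rewrite linearZ /= truncation_ket; case: ifPn => // nr.
by rewrite truncation_ket0 // scaler0.
Qed.

End Truncation.

Theorem mainTheorem8 (R : realType) (m n k : nat) (hmn : (2 <= m + n)%N)
    (hk : (1 < k)%N)
    (F : clqModule R m n k) (vac : F) (hF : is_fock vac)
    (W : clqModule R m n k) (p : {linear F -> W}) (hW : is_truncation vac p)
    (dot : {dot W for Num.conj}) (hdot : is_fock_product (p vac) dot) :
  [/\ lbasis (trunc_occ k) (nket (p vac)) /\
      (forall r s : occ m n, trunc_occ k r -> trunc_occ k s ->
         dot (nket (p vac) r) (nket (p vac) s) = (r == s)%:R),

      forall r : occ m n, trunc_occ k r ->
      [/\ forall j : 'I_(m + n).-1,
            rho_H j (nket (p vac) r) =
              (- ((r (ord_first j))%:R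
                  + (-1) ^+ deg m (ord_next j) * (r (ord_next j))%:R))
              *: nket (p vac) r,

          forall j l : 'I_(m + n), (j < l)%N ->
            rho_e j l (nket (p vac) r) =
              (- (1 - (1 - (deg m l)%:R) * (r l)%:R)
               * (-1) ^ (((deg m j)%:Z - (deg m l)%:Z)
                           * (\sum_(i < m + n | (i <= j)%N) r i)%:Z
                         + (1 - (deg m l)%:Z)
                           * (\sum_(i < m + n | (j < i < l)%N) r i)%:Z)
               * expi (- (pi * ((\sum_(i < m + n | (j <= i < l)%N) r i)%:R
                                + (-1) ^+ deg m l * (r l)%:R
                                - 2 * (deg m l)%:R) / k%:R))
               * hop_amplitude k j l r)
              *: nket (p vac) (hop j l r) &

          forall j l : 'I_(m + n), (l < j)%N ->
            rho_e j l (nket (p vac) r) =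
              (- (1 - (1 - (deg m l)%:R) * (r l)%:R)
               * (-1) ^ (((deg m l)%:Z - (deg m j)%:Z)
                           * (\sum_(i < m + n | (i <= l)%N) r i)%:Z
                         + (1 - (deg m j)%:Z)
                           * (\sum_(i < m + n | (l < i < j)%N) r i)%:Z)
               * expi (pi * ((\sum_(i < m + n | (l <= i < j)%N) r i)%:R
                             + (-1) ^+ deg m j * (r j)%:R) / k%:R)
               * hop_amplitude k j l r)
              *: nket (p vac) (hop j l r)] &

      [/\ forall r : nat, (r <= m * (k - 1) + n)%N ->
            irreducible_submodule (fock_layer (p vac) r),
          direct_sum (fun r : 'I_(m * (k - 1) + n).+1 =>
            fock_layer (p vac) r) &
          (m * (k - 1) + n).+1 = (m * k - m + n + 1)%N]].
Proof.
have nb0 := truncation_nb_vac hW hF.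
have k0 := truncation_ket0 hW; have ks := truncation_ket_span hW hF.
split; first split.
- exact: nket_lbasis nb0 ks hdot.
- exact: nket_orthonormal nb0 hdot.
- move=> r tr; split=> [j|j l jl|j l lj].
  + exact: rho_H_nket.
  + by rewrite (rho_e_lt hk nb0 k0 hdot) // /e_coef jl.
  + by rewrite (rho_e_gt hk nb0 k0 hdot) // /e_coef ltnNge ltnW.
- split=> [a aM||].
  + exact: fock_layer_irreducible nb0 k0 ks hdot _ aM.
  + exact: fock_layer_direct_sum nb0 ks hdot.
  + by rewrite mulnBr muln1 addn1.
Qed.
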